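(* Let $(M,F)$ be a Berwald structure with linear Berwald connection $\nabla^b$, and let $h$ be any Riemannian metric on $M$ such that $\nabla^b\pi^*h=0$. Then the Levi-Civita connection $\nabla^h$ of $h$ leaves the indicatrix of $F$ invariant under (horizontal) parallel transport, i.e. for every path $\gamma$ in $M$ from $x$ to $z$, the parallel transport of $\nabla^h$ along $\gamma$ maps $I_x$ onto $I_z$.
   Context: Finsler structure: $M$ is a smooth $n$-manifold, $N=TM\setminus\{0\}$, $\pi:N\to M$; $F:TM\to[0,\infty)$ is smooth on $N$, satisfies $F(x,\lambda y)=\lambda F(x,y)$ for $\lambda>0$, and $g_{ij}(x,y)=\frac12\frac{\partial^2F^2}{\partial y^i\partial y^j}$ is positive definite on $N$. The indicatrix at $x$ is $I_x=\{y\in T_xM:F(x,y)=1\}$. Put $A_{ijk}=\frac F2\frac{\partial g_{ij}}{\partial y^k}$, $\gamma^i_{jk}=\frac12 g^{is}(\partial_{x^k}g_{sj}-\partial_{x^s}g_{jk}+\partial_{x^j}g_{sk})$, $N^i_j=\gamma^i_{jk}y^k-\frac1F A^i_{jk}\gamma^k_{rs}y^ry^s$ (indices are raised with $g^{ij}$), $\frac{\delta}{\delta x^j}=\frac{\partial}{\partial x^j}-N^i_j\frac{\partial}{\partial y^i}$ (horizontal vectors), $\delta y^i=dy^i+N^i_jdx^j$. Chern connection: $\pi^*TM\to N$ is the pull-back bundle, with fibre $T_{\pi(u)}M$ over $u$. The Chern connection is the unique linear connection on $\pi^*TM$ with connection forms $\omega^i_j=\Gamma^i_{jk}(x,y)dx^k$,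 $\Gamma^i_{jk}=\Gamma^i_{kj}$, and $dg_{ij}-g_{kj}\omega^k_i-g_{ik}\omega^k_j=2A_{ijk}\frac{\delta y^k}{F}$. $(M,F)$ is Berwald if the $\Gamma^i_{jk}$ in natural coordinates do not depend on $y$. The linear Berwald connection $\nabla^b$ on $\pi^*TM$ has connection forms ${}^b\Gamma^i_{jk}dx^k$ with ${}^b\Gamma^i_{jk}=\partial N^i_j/\partial y^k$; for a Berwald structure $\nabla^b$ coincides with the Chern connection. $\pi^*h$ is the fibre metric on $\pi^*TM$ given by $(\pi^*h)_u=h_{\pi(u)}$. Horizontal parallel transport for $\nabla^h$ means parallel transport by the pull-back connection $\pi^*\nabla^h$ on $\pi^*TM$ (defined by $(\pi^*\nabla^h)_{\iota(X)}\pi^*S=\pi^*(\nabla^h_XS)$, where $\iota(X)=X^i\frac{\delta}{\delta x^i}$) along horizontal lifts of paths in $M$; under the identification of the fibres with tangent spaces of $M$ it is $\nabla^h$-parallel transport along the path. *)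

(* Defs.v *)
From HB Require Import structures.
From mathcomp Require Import all_boot all_order all_algebra.
From mathcomp Require Import all_classical all_reals all_analysis.
Import Order.TTheory GRing.Theory Num.Theory.
Import numFieldNormedType.Exports.

Set Implicit Arguments.
Unset Strict Implicit.
Unset Printing Implicit Defensive.

Local Open Scope classical_set_scope.
Local Open Scope ring_scope.

Section Smooth.
Context {R : realType} {V W : normedModType R}.

(* On an open set U of a finite-dimensional V this is the usual class C^k:
   for k.+1, Fréchet differentiable with C^k directional derivatives. *)
Fixpoint Ck (k : nat) (U : set V) (f : V -> W) : Prop :=
  if k is k'.+1 then
    (forall x, U x -> differentiable f x) /\
    (forall v : V, Ck k' U (fun x => 'D_v f x))
  else forall x, U x -> {for x, continuous f}.

Definition smooth_on (U : set V) (f : V -> W) : Prop := forall k, Ck k U f.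

End Smooth.

(* A chart of M is the homeomorphism chart_map from the open set chart_dom onto
   an open set chart_cod of R^n, with inverse chart_inv; the values of the total
   functions chart_map and chart_inv outside these sets are irrelevant. *)
Record chart (R : realType) (n : nat) (M : topologicalType) := Chart {
  chart_dom : set M;
  chart_cod : set 'rV[R]_n;
  chart_map : M -> 'rV[R]_n;
  chart_inv : 'rV[R]_n -> M;
  chart_dom_open : open chart_dom;
  chart_cod_open : open chart_cod;
  chart_map_cod : forall p, chart_dom p -> chart_cod (chart_map p);
  chart_inv_dom : forall x, chart_cod x -> chart_dom (chart_inv x);
  chart_mapK : forall p, chart_dom p -> chart_inv (chart_map p) = p;
  chart_invK : forall x, chart_cod x -> chart_map (chart_inv x) = x;
  chart_map_cts : forall p, chart_dom p -> {for p, continuous chart_map};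
  chart_inv_cts : forall x, chart_cod x -> {for x, continuous chart_inv}
}.

Section Transition.
Context {R : realType} {n : nat} {M : topologicalType}.
Implicit Types a b : chart R n M.

Definition overlap a b : set 'rV[R]_n :=
  [set x | chart_cod a x /\ chart_dom b (chart_inv a x)].

Definition transition a b : 'rV[R]_n -> 'rV[R]_n :=
  fun x => chart_map b (chart_inv a x).

End Transition.

(* Smooth n-manifold given by a smooth atlas, indexed by the type atlas.  The
   function chart_at selects a chart around each point; it only serves to
   represent tangent vectors (see tcoord below). *)
Record smooth_manifold (R : realType) (n : nat) := SmoothManifold {
  carrier :> topologicalType;
  manifold_hausdorff : hausdorff_space carrier;
  manifold_second_countable : @second_countable carrier;
  atlas : Type;
  chart_of : atlas -> chart R n carrier;
  chart_at : carrier -> atlas;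
  chart_at_dom : forall p, chart_dom (chart_of (chart_at p)) p;
  transition_smooth : forall a b : atlas,
    smooth_on (overlap (chart_of a) (chart_of b))
              (transition (chart_of a) (chart_of b))
}.

Section Manifold.
Context {R : realType} {n : nat} (M : smooth_manifold R n).
Local Notation E := 'rV[R]_n.
Local Notation cmap a := (chart_map (chart_of (a : atlas M))).
Local Notation cinv a := (chart_inv (chart_of (a : atlas M))).
Local Notation cdom a := (chart_dom (chart_of (a : atlas M))).
Local Notation ccod a := (chart_cod (chart_of (a : atlas M))).
Local Notation trans a b :=
  (transition (chart_of (a : atlas M)) (chart_of (b : atlas M))).

(* T_pM is represented by R^n: a vector v : E at p stands for the tangent vector
   whose components in the chart chart_at p are v.  Its components in another
   chart a around p are then obtained with the derivative of the transition
   map. *)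
Definition tcoord (a : atlas M) (p : M) (v : E) : E :=
  'D_v (trans (chart_at p) a) (cmap (chart_at p) p).

(* Tangent vector at (cinv a x) with components y in the chart a. *)
Definition tvec (a : atlas M) (x y : E) : E :=
  'D_y (trans a (chart_at (cinv a x))) x.

(* Image of N = TM minus the zero section in the natural coordinates (x, y). *)
Definition slit (a : atlas M) : set (E * E)%type :=
  [set u | ccod a u.1 /\ u.2 != 0].

Definition coef3 := 'I_n -> 'I_n -> 'I_n -> R.

(* (chr G v xi)^i = G^i_jk v^j xi^k *)
Definition chr (G : coef3) (v xi : E) : E :=
  \row_i \sum_j \sum_k G i j k * v 0 j * xi 0 k.

(* omega^k_i (xi) = G^k_il xi^l, for omega^k_i = G^k_il dx^l *)
Definition conn_form (G : coef3) (xi : E) (k i : 'I_n) : R :=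
  \sum_l G k i l * xi 0 l.

Record lin_conn := LinConn {
  lc_coef : atlas M -> E -> coef3;
  lc_smooth : forall a i j k,
    smooth_on (ccod a) (fun x => lc_coef a x i j k);
  lc_change : forall a b x (v xi : E),
    overlap (chart_of a) (chart_of b) x ->
    'D_(chr (lc_coef a x) v xi) (trans a b) x =
      'D_xi (fun x' => 'D_v (trans a b) x') x +
      chr (lc_coef b (trans a b x))
          ('D_v (trans a b) x) ('D_xi (trans a b) x)
}.

(* Linear connection on pi^*TM with connection forms
   omega^i_j = Gamma^i_jk(x,y) dx^k (no dy-part). *)
Record pullback_conn := PullbackConn {
  pc_coef : atlas M -> E * E -> coef3;
  pc_smooth : forall a i j k,
    smooth_on (slit a) (fun u => pc_coef a u i j k);
  pc_change : forall a b x y (v xi : E),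
    overlap (chart_of a) (chart_of b) x -> y != 0 ->
    'D_(chr (pc_coef a (x, y)) v xi) (trans a b) x =
      'D_xi (fun x' => 'D_v (trans a b) x') x +
      chr (pc_coef b (trans a b x, 'D_y (trans a b) x))
          ('D_v (trans a b) x) ('D_xi (trans a b) x)
}.

(* Component (i, j) at u of the covariant derivative, in the direction
   w = (dx, dy) tangent to N, of the fibre metric G on pi^*TM, for the
   connection forms Gamma^i_jk dx^k:
   dG_ij - G_kj omega^k_i - G_ik omega^k_j. *)
Definition cov_metric (Gamma : E * E -> coef3)
    (G : 'I_n -> 'I_n -> E * E -> R) (i j : 'I_n) (u w : E * E) : R :=
  'D_w (G i j) u
  - \sum_k G k j u * conn_form (Gamma u) w.1 k i
  - \sum_k G i k u * conn_form (Gamma u) w.1 k j.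

Section LocalFinsler.
(* L : F in natural coordinates (x, y) *)
Variable L : E * E -> R.

Definition dx (k : 'I_n) (f : E * E -> R) (u : E * E) : R :=
  'D_((delta_mx 0 k, 0) : E * E) f u.
Definition dy (k : 'I_n) (f : E * E -> R) (u : E * E) : R :=
  'D_((0, delta_mx 0 k) : E * E) f u.

Definition fund (i j : 'I_n) (u : E * E) : R :=
  2^-1 * dy i (dy j (fun u' => L u' ^+ 2)) u.

Definition fund_inv (i j : 'I_n) (u : E * E) : R :=
  invmx (\matrix_(k, l) fund k l u) i j.

Definition cartan (i j k : 'I_n) (u : E * E) : R :=
  L u / 2 * dy k (fund i j) u.

Definition cartan_up (i j k : 'I_n) (u : E * E) : R :=
  \sum_s fund_inv i s u * cartan s j k u.

Definition gamma (i j k : 'I_n) (u : E * E) : R :=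
  2^-1 * \sum_s fund_inv i s u *
    (dx k (fund s j) u - dx s (fund j k) u + dx j (fund s k) u).

Definition nonlin (i j : 'I_n) (u : E * E) : R :=
  \sum_k gamma i j k u * u.2 0 k
  - (L u)^-1 * \sum_k cartan_up i j k u *
      (\sum_r \sum_s gamma k r s u * u.2 0 r * u.2 0 s).

(* (delta y^k)(w) *)
Definition delta_y (k : 'I_n) (u w : E * E) : R :=
  w.2 0 k + \sum_j nonlin k j u * w.1 0 j.

Definition berwald_coef (u : E * E) : coef3 :=
  fun i j k => dy k (nonlin i j) u.

End LocalFinsler.

Definition local_F (F : M -> E -> R) (a : atlas M) (u : E * E) : R :=
  F (cinv a u.1) (tvec a u.1 u.2).

Record finsler (F : M -> E -> R) : Prop := Finsler {
  finsler_ge0 : forall p y, 0 <= F p y;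
  finsler_smooth : forall a, smooth_on (slit a) (local_F F a);
  finsler_hom : forall p y (l : R), 0 < l -> F p (l *: y) = l * F p y;
  finsler_pos : forall a u (v : E), slit a u -> v != 0 ->
    0 < \sum_i \sum_j fund (local_F F a) i j u * v 0 i * v 0 j
}.

Definition indicatrix (F : M -> E -> R) (p : M) : set E :=
  [set y | F p y = 1].

Definition chern (F : M -> E -> R) (D : pullback_conn) : Prop :=
  forall a u, slit a u ->
    (forall i j k, pc_coef D a u i j k = pc_coef D a u i k j) /\
    (forall i j (w : E * E),
      cov_metric (pc_coef D a) (fund (local_F F a)) i j u w =
      2 * \sum_k cartan (local_F F a) i j k u *
            (delta_y (local_F F a) k u w / local_F F a u)).

Definition berwald (F : M -> E -> R) : Prop :=
  exists D : pullback_conn, chern F D /\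
    forall a x y y', slit a (x, y) -> slit a (x, y') ->
      pc_coef D a (x, y) = pc_coef D a (x, y').

Definition local_metric (h : M -> E -> E -> R) (a : atlas M)
    (i j : 'I_n) (x : E) : R :=
  h (cinv a x) (tvec a x (delta_mx 0 i)) (tvec a x (delta_mx 0 j)).

Record riemannian (h : M -> E -> E -> R) : Prop := Riemannian {
  riem_lin : forall p u, scalar (h p u);
  riem_sym : forall p u v, h p u v = h p v u;
  riem_pos : forall p v, v != 0 -> 0 < h p v v;
  riem_smooth : forall a i j, smooth_on (ccod a) (local_metric h a i j)
}.

(* nabla^b (pi^* h) = 0 *)
Definition berwald_parallel (F : M -> E -> R) (h : M -> E -> E -> R) : Prop :=
  forall a u, slit a u -> forall i j (w : E * E),
    cov_metric (berwald_coef (local_F F a))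
      (fun k l u' => local_metric h a k l u'.1) i j u w = 0.

Definition levi_civita (h : M -> E -> E -> R) (D : lin_conn) : Prop :=
  forall a x, ccod a x ->
    (forall i j k, lc_coef D a x i j k = lc_coef D a x i k j) /\
    (forall i j (xi : E),
      'D_xi (local_metric h a i j) x =
        \sum_k local_metric h a k j x * conn_form (lc_coef D a x) xi k i
        + \sum_k local_metric h a i k x * conn_form (lc_coef D a x) xi k j).

(* Continuous on [0, 1] and, outside a finite set S, continuously
   differentiable, the derivative having finite one-sided limits everywhere. *)
Definition piecewise_C1 (c : R -> M) : Prop :=
  {within `[0%R, 1%R], continuous c} /\
  exists S : seq R, forall a (t : R), t \in `[0, 1] -> cdom a (c t) ->
    [/\ t \in `]0, 1[ -> t \notin S ->
          derivable (cmap a \o c) t 1 /\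
          {for t, continuous (derive1 (cmap a \o c))},
        t < 1 -> cvg (derive1 (cmap a \o c) s @[s --> t^'+])
      & 0 < t -> cvg (derive1 (cmap a \o c) s @[s --> t^'-])].

(* V t, for t in [0, 1], is a tangent vector at c t. *)
Definition parallel (D : lin_conn) (c : R -> M) (V : R -> E) : Prop :=
  exists S : seq R, forall a (t : R), t \in `[0, 1] -> cdom a (c t) ->
    let Va (s : R) := tcoord a (c s) (V s) in
    Va s @[s --> within `[0%R, 1%R] (nbhs t)] --> Va t /\
    (t \in `]0, 1[ -> t \notin S ->
       derivable Va t 1 /\
       derive1 Va t = - chr (lc_coef D a (cmap a (c t))) (Va t)
                        (derive1 (cmap a \o c) t)).

(* Parallel transport T_{c 0}M -> T_{c 1}M along c; 0 is only a default value,
   used if no parallel field along c extends v. *)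
Definition transport (D : lin_conn) (c : R -> M) (v : E) : E :=
  xget 0 [set w | exists V, [/\ parallel D c V, V 0 = v & V 1 = w]].

End Manifold.

(* Main.v *)
Require Import Defs.
From HB Require Import structures.
From mathcomp Require Import all_boot all_order all_algebra.
From mathcomp Require Import all_classical all_reals all_analysis.
From mathcomp Require Import ring lra.
Import Order.TTheory GRing.Theory Num.Theory.
Import numFieldNormedType.Exports.
Local Open Scope classical_set_scope.
Local Open Scope ring_scope.

Set Implicit Arguments.
Unset Strict Implicit.
Unset Printing Implicit Defensive.


(** The proof identifies the Levi-Civita connection of h with the Chern
    connection of F, and then checks that the Chern connection preserves F.

    In a chart, let Gamma be the coefficients of the Chern connection, E = F^2
    and g_ij the fundamental tensor.  Euler's relation for E, differentiated in
    y, gives g_ij y^i y^j = E and shows that the Cartan tensor vanishes when its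
    second slot is filled with y (fund_contract2, dfund_contract).
    With these identities the definition of N collapses to
    N^i_j = Gamma^i_jk y^k (chern_nonlin).  When Gamma does not depend on y, the
    linear Berwald connection dN^i_j/dy^k therefore has the coefficients
    Gamma^i_jk, which are symmetric in j and k.  As it is also compatible with
    h, the uniqueness of a torsion-free metric connection forces
    Gamma to be the Levi-Civita connection of h (levi_civita_chern).

    The vector (xi, - Gamma y xi) is horizontal, and on horizontal vectors the
    Chern equation says that g is parallel; since E = g_ij y^i y^j, the function
    E has derivative zero there (horizontal_sq).  These are the velocities of
    the curves (c, V) with V parallel along c, so F(V)^2 is constant as long as V
    stays away from the zero section, where F is smooth (parallel_finsler).
    That V does not reach the zero section, and that it is determined by its
    value at one point, both follow from the constancy of h(U, V) for
    parallel U and V (parallel_metric).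

    It remains to know that parallel fields with a given value at either end of
    the path exist, so that the transport is defined everywhere and onto.  In a
    chart the equation is a linear differential equation, solved near each
    point by Picard iteration (linear_ode_local); solutions on adjacent
    intervals are glued, and an induction on intervals gives the whole path
    (transportable_path). *)

(** * Directional derivatives and symmetry of second derivatives *)

Section DirectionalDerivatives.
Context {R : realType} {V W : normedModType R}.
Implicit Types (f : V -> W) (x u v : V).

Lemma derive_addv f x u v : differentiable f x ->
  'D_(u + v) f x = 'D_u f x + 'D_v f x.
Proof. by move=> df; rewrite !deriveE// linearD. Qed.

Lemma derive_scalev f x (k : R) v : differentiable f x ->
  'D_(k *: v) f x = k *: 'D_v f x.
Proof. by move=> df; rewrite !deriveE// linearZ. Qed.

Lemma derive_oppv f x v : differentiable f x -> 'D_(- v) f x = - 'D_v f x.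
Proof. by move=> df; rewrite !deriveE// linearN. Qed.

Lemma derive_sumv f x (I : finType) (v : I -> V) : differentiable f x ->
  'D_(\sum_i v i) f x = \sum_i 'D_(v i) f x.
Proof.
by move=> df; rewrite deriveE// linear_sum; apply: eq_bigr => i _; rewrite deriveE.
Qed.

Lemma is_derive_curve (g : R -> V) f (t : R) (dg : V) : is_derive t 1 g dg ->
  differentiable f (g t) -> is_derive t 1 (f \o g) ('D_dg f (g t)).
Proof.
move=> [/derivable1_diffP dgt <-] df; split.
  by apply/derivable1_diffP; exact: differentiable_comp.
have dfg : differentiable (f \o g) t by exact: differentiable_comp.
by rewrite (deriveE _ dfg) (diff_comp dgt df) (deriveE _ df) (deriveE _ dgt).
Qed.

Lemma is_derive_line f x v (t : R) : differentiable f (t *: v + x) ->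
  is_derive t 1 (fun s : R => f (s *: v + x)) ('D_v f (t *: v + x)).
Proof.
move=> df.
have dg : is_derive t 1 (fun s : R => s *: v + x) v.
  have -> : (fun s : R => s *: v + x) = ( *:%R^~ v) + cst x by apply/funext.
  rewrite -[X in is_derive _ _ _ X]addr0; apply: is_deriveD.
  split; first exact/derivable1_diffP.
  by rewrite deriveE// diff_val scale1r.
exact: (is_derive_curve dg df).
Qed.

(** The derivative in the direction v only sees f on a line; this is needed for
    functions that are known to agree on a line but not on an open set. *)
Lemma derive_lineE f x v :
  'D_v f x = 'D_1 (fun s : R => f (s *: v + x)) 0.
Proof.
rewrite /derive; set g1 := fun h => h^-1 *: _; set g2 := fun h => h^-1 *: _.
suff -> : g2 = g1 by [].
by rewrite funeqE /g1 /g2 => h /=; rewrite addr0 scale0r add0r [_%:A]mulr1.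
Qed.

End DirectionalDerivatives.

Lemma derive_chain (R : realType) (U V W : normedModType R) (f : U -> V)
  (g : V -> W) x v : differentiable f x -> differentiable g (f x) ->
  'D_v (g \o f) x = 'D_('D_v f x) g (f x).
Proof.
move=> df dg; have dgf : differentiable (g \o f) x by exact: differentiable_comp.
by rewrite (deriveE _ dgf) (diff_comp df dg) (deriveE _ df) (deriveE _ dg).
Qed.

Section Schwarz.
Context {R : realType} {V : normedModType R}.
Implicit Types (f : V -> R) (x u v : V) (U : set V).

(** The mean value theorem, applied first to s |-> f (s u + t v + x) - f (s u + x)
    and then to the derivative of f in the direction u, along v. *)
Lemma second_increment f U x u v (t : R) : Ck 2 U f -> 0 < t ->
  (forall s1 s2 : R, s1 \in `[0, t] -> s2 \in `[0, t] ->
     U (s1 *: u + (s2 *: v + x))) ->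
  exists s1 s2, [/\ s1 \in `[0, t], s2 \in `[0, t] &
    f (t *: u + (t *: v + x)) - f (t *: u + x) - f (t *: v + x) + f x =
    t ^+ 2 * 'D_v ('D_u f) (s1 *: u + (s2 *: v + x))].
Proof.
move=> [df dDf] t0 HU.
have It : t \in `[0, t] by rewrite in_itv /= ltW //=.
have I0 : 0 \in `[0, t] by rewrite in_itv /= lexx ltW.
have oo s : s \in `]0, t[ -> s \in `[0, t] by exact: subset_itv_oo_cc.
pose phi (s : R) := f (s *: u + (t *: v + x)) - f (s *: u + x).
have dphi s : s \in `[0, t] ->
    is_derive s 1 phi ('D_u f (s *: u + (t *: v + x)) - 'D_u f (s *: u + x)).
  move=> Is; apply: is_deriveB; apply: is_derive_line; apply: df.
    exact: HU.
  by have := HU s 0 Is I0; rewrite scale0r add0r.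
have cphi : {within `[0, t], continuous phi}.
  apply: derivable_within_continuous => s Is.
  by have [] := dphi s Is.
have [s1 I1] := MVT t0 (fun s Is => dphi s (oo s Is)) cphi.
rewrite subr0 => E1.
pose psi (s : R) := 'D_u f (s *: v + (s1 *: u + x)).
have dpsi s : s \in `[0, t] ->
    is_derive s 1 psi ('D_v ('D_u f) (s *: v + (s1 *: u + x))).
  move=> Is; apply: is_derive_line; apply: (dDf u).1.
  by rewrite addrCA; apply: HU => //; exact: oo.
have cpsi : {within `[0, t], continuous psi}.
  apply: derivable_within_continuous => s Is.
  by have [] := dpsi s Is.
have [s2 I2] := MVT t0 (fun s Is => dpsi s (oo s Is)) cpsi.
rewrite subr0 => E2.
exists s1, s2; split; [exact: oo|exact: oo|].
move: E1 E2; rewrite /phi /psi !scale0r !add0r.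
rewrite [t *: v + (s1 *: u + x)]addrCA [s2 *: v + (s1 *: u + x)]addrCA => E1 E2.
rewrite E2 in E1.
by move: E1; rewrite -mulrA -expr2 (mulrC _ (t ^+ 2)) => <-; ring.
Qed.

(** The second increment of f is symmetric in u and v, so that it equals t^2
    times a value of each of the two mixed derivatives, at points that tend to x
    with t. *)
Lemma schwarz f U x u v : open U -> Ck 2 U f -> U x ->
  'D_u ('D_v f) x = 'D_v ('D_u f) x.
Proof.
move=> oU CU Ux; have [df dDf] := CU.
apply: contrapT => /eqP; set a := 'D_u ('D_v f) x; set b := 'D_v ('D_u f) x => ab.
have e0 : 0 < `|a - b| / 2 by rewrite divr_gt0// normr_gt0 subr_eq0.
have na := (@cvgrPdist_lt _ _ _ _ _ _ _).1 ((dDf v).2 u x Ux) _ e0.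
have nb := (@cvgrPdist_lt _ _ _ _ _ _ _).1 ((dDf u).2 v x Ux) _ e0.
have nU := open_nbhs_nbhs (conj oU Ux).
have nUab : \forall y \near x, [/\ U y, `|a - 'D_u ('D_v f) y| < `|a - b| / 2
    & `|b - 'D_v ('D_u f) y| < `|a - b| / 2].
  exact: filterS3 (fun y h1 h2 h3 => And3 h1 h2 h3) nU (na _) (nb _).
have [r /= r0 Hr] := (nbhs_ballP _ _).1 nUab.
clearbody a b; clear na nb nU.
pose t := r / (`|u| + `|v| + 1) / 2.
have D0 : 0 < `|u| + `|v| + 1 by rewrite ltr_wpDl// addr_ge0.
have t0 : 0 < t by rewrite !divr_gt0.
have tr : t * (`|u| + `|v|) < r.
  rewrite /t (@le_lt_trans _ _ (r / 2))//; last first.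
    by rewrite ltr_pdivrMr// ltr_pMr// ltr1n.
  rewrite mulrAC ler_pM2r ?invr_gt0// mulrAC ler_pdivrMr// ler_pM2l//.
  by rewrite lerDl.
have Hball u' v' : `|u'| + `|v'| <= `|u| + `|v| -> forall s1 s2 : R, s1 \in `[0, t] ->
    s2 \in `[0, t] -> ball x r (s1 *: u' + (s2 *: v' + x)).
  move=> uv s1 s2; rewrite !in_itv /= => /andP[s10 s1t] /andP[s20 s2t].
  rewrite -ball_normE /ball_ /= addrA opprD addrCA subrr addr0 normrN.
  apply: le_lt_trans tr; apply: (@le_trans _ _ (t * (`|u'| + `|v'|))); last first.
    by rewrite ler_pM2l.
  rewrite (le_trans (ler_normD _ _))// !normrZ mulrDr !ger0_norm// lerD//;
    exact: ler_wpM2r.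
have Buv := Hball u v (lexx _).
have Bvu := Hball v u (eq_ind _ (fun z => _ <= z) (lexx _) _ (addrC _ _)).
have [s1 [s2 [I1 I2 E]]] := second_increment CU t0
  (fun s1 s2 J1 J2 => let: And3 h _ _ := Hr _ (Buv s1 s2 J1 J2) in h).
have [r1 [r2 [J1 J2 E']]] := second_increment CU t0
  (fun s1 s2 J1 J2 => let: And3 h _ _ := Hr _ (Bvu s1 s2 J1 J2) in h).
have [_ _ nbb] := Hr _ (Buv s1 s2 I1 I2).
have [_ naa _] := Hr _ (Bvu r1 r2 J1 J2).
have EE : 'D_v ('D_u f) (s1 *: u + (s2 *: v + x)) =
          'D_u ('D_v f) (r1 *: v + (r2 *: u + x)).
  apply: (@mulfI _ (t ^+ 2)); first by rewrite expf_neq0// gt_eqF.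
  apply: (etrans (esym E)); apply: (etrans _ E').
  rewrite [t *: v + (t *: u + x)]addrCA; congr (_ + _); exact: addrAC.
rewrite EE distrC in nbb.
have := ltrD naa nbb; rewrite -splitr => /(le_lt_trans (ler_distD _ a b)).
by rewrite ltxx.
Qed.

End Schwarz.

(** * Algebra of functions of class C^k *)

Section CkAlgebra.
Context {R : realType} {V : normedModType R}.
Implicit Types (f g : V -> R) (U : set V).

Lemma near_eq_differentiable {W : normedModType R} (f g : V -> W) (x : V) :
  (\near x, f x = g x) -> differentiable f x -> differentiable g x.
Proof.
move=> fg df.
have gx : g x = f x by rewrite (nbhs_singleton fg).
apply/diffP; apply: (@getPex _ (fun (dg : {linear V -> W}) => continuous dg /\
  forall y, g y = g (lim (nbhs x)) + dg (y - lim (nbhs x))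
                  +o_(y \near x) (y - lim (nbhs x)))).
exists ('d f x); split; first exact: diff_continuous.
have /diffE E := df.
set k := (fun y => 'd f x (y - lim (nbhs x))).
suff H : g = cst (g (lim (nbhs x))) + k +o_ (nbhs x) (fun y => y - lim (nbhs x)).
  by move=> y; have /(congr1 (fun h => h y)) := H.
apply/eqaddoP => e e0.
have {}E : f = cst (f (lim (nbhs x))) + k +o_ (nbhs x) (fun y => y - lim (nbhs x)).
  by apply/funext => y; rewrite {1}E.
have /eqaddoP := E => /(_ e e0).
rewrite lim_id// gx; apply: filterS2 fg => z.
by rewrite !fctE => ->.
Qed.

Lemma open_near U x (P : set V) : open U -> U x -> (forall y, U y -> P y) ->
  \forall y \near x, P y.
Proof. by move=> oU Ux UP; apply: filterS UP _; exact: open_nbhs_nbhs. Qed.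

Lemma Ck_eq k U f g : open U -> (forall x, U x -> f x = g x) ->
  Ck k U f -> Ck k U g.
Proof.
move=> oU; elim: k f g => [|k IH] f g fg /=.
  move=> cf x Ux; have nfg := open_near oU Ux fg.
  suff : g y @[y --> x] --> f x by rewrite (fg x Ux).
  apply: cvg_trans (cf x Ux).
  exact: near_eq_cvg.
move=> [df Df]; split=> [x Ux|v].
  exact: near_eq_differentiable (open_near oU Ux fg) (df x Ux).
apply: (IH _ _ _ (Df v)) => x Ux.
exact: near_eq_derive (open_near oU Ux fg).
Qed.

Lemma Ck_le k U f : Ck k.+1 U f -> Ck k U f.
Proof.
elim: k f => [|k IH] f [df Df] /=.
  by move=> x Ux; apply: differentiable_continuous; exact: df.
by split=> // v; apply: IH.
Qed.

Lemma Ck_add k U f g : open U -> Ck k U f -> Ck k U g -> Ck k U (f + g).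
Proof.
move=> oU; elim: k f g => [|k IH] f g /=.
  by move=> cf cg x Ux; apply: continuousD; [exact: cf|exact: cg].
move=> [df Df] [dg Dg]; split=> [x Ux|v].
  by apply: differentiableD; [exact: df|exact: dg].
apply: (Ck_eq oU _ (IH _ _ (Df v) (Dg v))) => x Ux.
by rewrite deriveD//; apply: diff_derivable; [exact: df|exact: dg].
Qed.

Lemma Ck_mul k U f g : open U -> Ck k U f -> Ck k U g -> Ck k U (f * g).
Proof.
move=> oU; elim: k f g => [|k IH] f g.
  by move=> cf cg x Ux; apply: continuousM; [exact: cf|exact: cg].
move=> Cf Cg; have [df Df] := Cf; have [dg Dg] := Cg; split=> [x Ux|v].
  by apply: differentiableM; [exact: df|exact: dg].
apply: (Ck_eq oU _ (Ck_add oU (IH _ _ (Ck_le Cf) (Dg v)) (IH _ _ (Ck_le Cg) (Df v)))).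
move=> x Ux.
by rewrite deriveM//; apply: diff_derivable; [exact: df|exact: dg].
Qed.

End CkAlgebra.

(** * Derivatives of functions of position and fibre coordinate *)

Lemma linear_function_diff (R : realType) (V W : normedModType R) (f : V -> W)
  (x v : V) : linear f -> continuous f ->
  differentiable f x /\ 'D_v f x = f v.
Proof.
move=> lf cf.
pose fM := GRing.isLinear.Build _ _ _ _ _ lf.
pose fL : {linear V -> W} := HB.pack f fM.
have df : differentiable f x by exact: (@linear_differentiable _ _ _ fL).
by split=> //; rewrite (deriveE _ df) -[f]/(fL : _ -> _) diff_lin.
Qed.

Section PairDerivatives.
Context {R : realType} {n : nat}.
Local Notation E := 'rV[R]_n.

Lemma sum_delta (a : 'I_n -> R) l : \sum_k a k * (delta_mx 0 l : E) 0 k = a l.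
Proof.
rewrite (bigD1 l)//= big1 ?addr0; first by rewrite mxE !eqxx mulr1.
by move=> k kj; rewrite mxE (negbTE kj) mulr0.
Qed.

Lemma pair_decomp (w : (E * E)%type) :
  w = \sum_k w.1 0 k *: ((delta_mx 0 k, 0) : E * E) +
      \sum_k w.2 0 k *: ((0, delta_mx 0 k) : E * E).
Proof.
apply: injective_projections.
  rewrite [RHS](raddfD fst) !(raddf_sum fst) /=.
  rewrite [X in _ + X]big1 ?addr0; last by move=> k _; rewrite scaler0.
  exact: row_sum_delta.
rewrite [RHS](raddfD snd) !(raddf_sum snd) /=.
rewrite [X in X + _]big1 ?add0r; last by move=> k _; rewrite scaler0.
exact: row_sum_delta.
Qed.

Lemma derive_pair (f : E * E -> R) (u w : (E * E)%type) : differentiable f u ->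
  'D_w f u = \sum_k w.1 0 k * dx k f u + \sum_k w.2 0 k * dy k f u.
Proof.
move=> df; rewrite {1}(pair_decomp w) (derive_addv _ _ df) !(derive_sumv _ df).
by congr (_ + _); apply: eq_bigr => k _; rewrite (derive_scalev _ _ df).
Qed.

Lemma derive_dy (f : E * E -> R) (u : (E * E)%type) (y : E) : differentiable f u ->
  'D_((0, y) : E * E) f u = \sum_k y 0 k * dy k f u.
Proof.
move=> df; apply: (etrans (derive_pair (0, y) df)).
rewrite [X in X + _]big1 ?add0r; first by [].
by move=> k _; rewrite mxE mul0r.
Qed.

Lemma snd_coord_diff (k : 'I_n) (u w : (E * E)%type) :
  differentiable (fun v : (E * E)%type => v.2 0 k) u /\
  'D_w (fun v : (E * E)%type => v.2 0 k) u = w.2 0 k.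
Proof.
apply: (@linear_function_diff _ _ _ (fun v : (E * E)%type => v.2 0 k)).
  by move=> a v v'; rewrite !mxE.
move=> v; apply: (@continuous_comp _ _ _ snd (fun y : E => y 0 k)).
  exact: cvg_snd.
exact: coord_continuous.
Qed.

Lemma derive_comp_fst (f : E -> R) (u w : (E * E)%type) :
  'D_w (fun v => f v.1) u = 'D_(w.1) f u.1.
Proof. by rewrite /derive. Qed.

(** The Leibniz rule for the contraction of a family G_k(x, y) with the fibre
    coordinate y^k itself.  The identities for the fundamental tensor arise by
    differentiating such contractions. *)
Lemma contract_diff (G : 'I_n -> E * E -> R) (u w : (E * E)%type) :
  (forall k, differentiable (G k) u) ->
  differentiable (fun v => \sum_k G k v * v.2 0 k) u /\
  'D_w (fun v => \sum_k G k v * v.2 0 k) u =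
    \sum_k ('D_w (G k) u * u.2 0 k + G k u * w.2 0 k).
Proof.
move=> dG; pose c k (v : (E * E)%type) := v.2 0 k.
have -> : (fun v => \sum_k G k v * v.2 0 k) = \sum_k (G k * c k).
  by apply/funext => v; rewrite fct_sumE.
have dc k : differentiable (c k) u by have [] := snd_coord_diff k u w.
split; first by apply: differentiable_sum => k; exact: differentiableM.
rewrite derive_sum; last first.
  by move=> k; apply: diff_derivable; exact: differentiableM.
apply: eq_bigr => k _; rewrite deriveM; [|exact: diff_derivable..].
have [_ ->] := snd_coord_diff k u w.
by rewrite addrC mulrC.
Qed.

Lemma dy_contract (G : 'I_n -> E * E -> R) (u : (E * E)%type) m :
  (forall k, differentiable (G k) u) ->
  dy m (fun v => \sum_k G k v * v.2 0 k) u =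
  \sum_k dy m (G k) u * u.2 0 k + G m u.
Proof.
move=> dG; have [_] := contract_diff (0, delta_mx 0 m) dG.
rewrite big_split /= => E1.
apply: (etrans E1); congr (_ + _); exact: (sum_delta (fun k => G k u)).
Qed.

End PairDerivatives.

(** * The Chern equations in one chart *)

Section MinkowskiNorms.
Context {R : realType} {n : nat}.
Local Notation E := 'rV[R]_n.
Context (U : set (E * E)%type) (L : E * E -> R).
Hypothesis U_open : open U.
Hypothesis L_smooth : smooth_on U L.
Hypothesis L_hom : forall u (l : R), U u -> 0 < l -> L (u.1, l *: u.2) = l * L u.
Hypothesis L_pos : forall u (v : E), U u -> v != 0 ->
  0 < \sum_i \sum_j fund L i j u * v 0 i * v 0 j.

Local Notation LL := (fun u => L u ^+ 2).

Lemma sq_Ck k : Ck k U LL.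
Proof.
have -> : LL = L * L by apply/funext => u; rewrite expr2.
exact: Ck_mul.
Qed.

Lemma dy_sq_Ck k i : Ck k U (dy i LL).
Proof. exact: (sq_Ck k.+1).2. Qed.

Lemma dy_dy_sq_Ck k i j : Ck k U (dy i (dy j LL)).
Proof. exact: (dy_sq_Ck k.+1 j).2. Qed.

Lemma differentiable_fund i j u : U u -> differentiable (fund L i j) u.
Proof.
move=> Uu; have -> : fund L i j = 2^-1 \*: dy i (dy j LL) by [].
by apply: differentiableZ; exact: (dy_dy_sq_Ck 1 i j).1.
Qed.

(** On the ray s |-> (x, (1 + s) y) the function L^2 is (1 + s)^2 L(x, y)^2; its
    derivative at s = 0 is Euler's relation. *)
Lemma euler u : U u -> \sum_k u.2 0 k * dy k LL u = 2 * L u ^+ 2.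
Proof.
move=> Uu; have dL : differentiable LL u by exact: (sq_Ck 1).1.
rewrite -(derive_dy _ dL).
have := @is_derive_line R _ _ LL u (0, u.2) 0.
rewrite scale0r add0r => /(_ dL) [_ <-].
pose p (s : R) := L u ^+ 2 *: (s + 1) ^+ 2.
have dp : is_derive (0 : R) 1 p (2 * L u ^+ 2).
  have -> : p = L u ^+ 2 \*: (id + cst 1) ^+ 2 by [].
  have d1 : is_derive (0 : R) 1 (id + cst 1 : R -> R) (1 + 0) by exact: is_deriveD.
  apply: (is_derive_eq (is_deriveZ _ (is_deriveX 2 d1))).
  rewrite !fctE /= add0r addr0 expr1n mulr1.
  by rewrite -[LHS]/(_ * (_ * 1)) mulr1 mulrC.
rewrite -(@derive_val _ _ _ _ _ _ _ dp); apply: near_eq_derive.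
have := @nbhs0_lt R R 1 ltr01; apply: filterS => s /ltr_normlP[s1 _].
have s0 : 0 < s + 1 by rewrite -ltrBlDr sub0r ltrNl.
have -> : s *: ((0, u.2) : (E * E)%type) + u = (u.1, (s + 1) *: u.2).
  by apply: injective_projections; rewrite /= ?scaler0 ?add0r// scalerDl scale1r.
by rewrite L_hom// exprMn mulrC.
Qed.

Lemma fundC i j u : U u -> fund L i j u = fund L j i u.
Proof.
move=> Uu.
pose e k := (0, delta_mx 0 k) : (E * E)%type.
exact: (congr1 ( *%R 2^-1) (schwarz (e i) (e j) U_open (sq_Ck 2) Uu)).
Qed.

(** Euler's relation differentiated with respect to y^j. *)
Lemma fund_contract j u : U u ->
  \sum_k fund L j k u * u.2 0 k = 2^-1 * dy j LL u.
Proof.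
move=> Uu.
have dk k : differentiable (dy k LL) u by exact: (dy_sq_Ck 1 k).1.
have := dy_contract j dk.
have -> : dy j (fun v => \sum_k dy k LL v * v.2 0 k) u = dy j (2 \*: LL) u.
  apply: near_eq_derive; apply: (open_near U_open Uu) => v Uv.
  by rewrite -[RHS]euler//; apply: eq_bigr => k _; rewrite mulrC.
have -> : dy j (2 \*: LL) u = 2 * dy j LL u.
  by rewrite /dy deriveZ//; apply: diff_derivable; exact: (sq_Ck 1).1.
rewrite mulr_natl mulr2n => /addIr ->.
by rewrite mulr_sumr; apply: eq_bigr => k _; rewrite mulrA.
Qed.

Lemma fund_contract2 u : U u ->
  \sum_j (\sum_k fund L j k u * u.2 0 k) * u.2 0 j = L u ^+ 2.
Proof.
move=> Uu; under eq_bigr do rewrite fund_contract// -mulrA (mulrC (dy _ _ _)).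
by rewrite -mulr_sumr euler// mulrA mulVf ?mul1r// pnatr_eq0.
Qed.

(** The relation fund_contract differentiated with respect to y^m: the derivative
    of the right-hand side is g_mj, and it cancels the term g_jm produced by
    the factor y^m because g is symmetric. *)
Lemma dfund_contract j m u : U u ->
  \sum_k dy m (fund L j k) u * u.2 0 k = 0.
Proof.
move=> Uu.
have dk k : differentiable (fund L j k) u by exact: differentiable_fund.
have := dy_contract m dk.
have -> : dy m (fun v => \sum_k fund L j k v * v.2 0 k) u = fund L m j u.
  have -> : fund L m j u = dy m (2^-1 \*: dy j LL) u.
    by rewrite [RHS]/dy deriveZ//; apply: diff_derivable; exact: (dy_sq_Ck 1 j).1.
  apply: near_eq_derive; apply: (open_near U_open Uu) => v Uv.
  exact: fund_contract.
by rewrite (fundC m j Uu) => /esym/eqP; rewrite -subr_eq0 addrK => /eqP.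
Qed.

Lemma cartan_contract2 i m u : U u -> \sum_k cartan L i k m u * u.2 0 k = 0.
Proof.
move=> Uu; transitivity (L u / 2 * \sum_k dy m (fund L i k) u * u.2 0 k).
  by rewrite mulr_sumr; apply: eq_bigr => k _; rewrite mulrA.
by rewrite dfund_contract// mulr0.
Qed.

(** Positive definiteness makes the matrix g invertible, so that lowering an
    index can be undone. *)
Lemma fund_invK i m u : U u ->
  \sum_s fund_inv L i s u * fund L s m u = (i == m)%:R.
Proof.
move=> Uu; set G := \matrix_(k, l) fund L k l u.
have uG : G \in unitmx.
  rewrite unitmxE unitfE; apply/det0P => -[v v0 vG].
  have := L_pos Uu v0; have -> : \sum_i \sum_j fund L i j u * v 0 i * v 0 j =
      (v *m G *m v^T) 0 0.
    rewrite mxE; under [RHS]eq_bigr do rewrite mxE mulr_suml.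
    rewrite exchange_big /=; apply: eq_bigr => a _; apply: eq_bigr => b _.
    by rewrite !mxE (mulrC (v 0 b)).
  by rewrite vG mul0mx mxE ltxx.
have := mulVmx uG => /matrixP/(_ i m); rewrite !mxE => <-.
by apply: eq_bigr => s _; rewrite !mxE.
Qed.

Section ChernConnection.
Variables (Gam : E * E -> coef3 (R := R) (n := n)) (u : (E * E)%type).
Hypothesis Uu : U u.
Hypothesis GamC : forall i j k, Gam u i j k = Gam u i k j.
Hypothesis Gam_chern : forall i j w, cov_metric Gam (fund L) i j u w =
  2 * \sum_k cartan L i j k u * (delta_y L k u w / L u).

Let y k := u.2 0 k.
Let g i j := fund L i j u.
Let A i j k := cartan L i j k u.
Let N i j := nonlin L i j u.
Let G i j k := Gam u i j k.
(* The two kinds of terms in dx^k g: those of the connection and those of the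
   Cartan tensor. *)
Let P i j k := \sum_m g i m * G m j k.
Let Q i j k := \sum_m A i j m * N m k.

(** The Chern equation in the direction d/dx^l, in which delta y^k takes the
    value N^k_l. *)
Lemma dx_fund i j l :
  dx l (fund L i j) u = P j i l + P i j l + 2 * ((L u)^-1 * Q i j l).
Proof.
have := Gam_chern i j (delta_mx 0 l, 0).
have cf a b : conn_form (Gam u) (delta_mx 0 l) a b = G a b l.
  exact: (sum_delta (fun l => G a b l)).
have dl k : delta_y L k u (delta_mx 0 l, 0) = N k l.
  rewrite /delta_y /= mxE add0r; exact: (sum_delta (fun l => N k l)).
rewrite /cov_metric /=.
under eq_bigr do rewrite cf (fundC _ _ Uu).
under [X in _ - _ - X]eq_bigr do rewrite cf.
under [X in _ = _ * X]eq_bigr do rewrite dl mulrA.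
rewrite -mulr_suml (mulrC _ (L u)^-1) => /eqP; rewrite !subr_eq => /eqP.
rewrite -/(dx _ _ _) => ->.
by rewrite -[X in _ + X + _]/(P i j l) -[X in _ + _ + X]/(P j i l)
  -[\sum_i0 _]/(Q i j l) addrC (addrC _ (P i j l)) addrA.
Qed.

Let low s j k :=
  2^-1 * (dx k (fund L s j) u - dx s (fund L j k) u + dx j (fund L s k) u).

(** Christoffel's combination cancels all the connection terms but one, as for a
    Levi-Civita connection; the Cartan terms remain. *)
Lemma lowE s j k :
  low s j k = P s j k + (L u)^-1 * (Q s j k - Q j k s + Q s k j).
Proof.
have PC a b c : P a b c = P a c b.
  by apply: eq_bigr => m _; rewrite /G GamC.
rewrite /low !dx_fund (PC j k s) (PC k s j) (PC s k j).
move: (P j s k) (P s j k) (P k j s) (Q s j k) (Q j k s) (Q s k j) (L u)^-1.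
by move=> p1 p2 p3 q1 q2 q3 r; field.
Qed.

Lemma Q_contract2 i l : \sum_k Q i k l * y k = 0.
Proof.
under eq_bigr do rewrite mulr_suml.
rewrite exchange_big big1 //= => m _.
under eq_bigr do rewrite mulrAC.
by rewrite -mulr_suml cartan_contract2// mul0r.
Qed.

Let n_ m := \sum_k N m k * y k.

(** Of the three Cartan terms of lowE, two have y in the second slot after
    contraction and vanish. *)
Lemma low_contract s j : \sum_k low s j k * y k =
  \sum_m g s m * (\sum_k G m j k * y k) + (L u)^-1 * \sum_m A s j m * n_ m.
Proof.
transitivity (\sum_k P s j k * y k + (L u)^-1 * (\sum_k Q s j k * y k
    - \sum_k Q j k s * y k + \sum_k Q s k j * y k)).
  rewrite -sumrB -big_split /= mulr_sumr -big_split /=.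
  apply: eq_bigr => k _; rewrite lowE.
  move: (P s j k) (Q s j k) (Q j k s) (Q s k j) (L u)^-1 (y k).
  by move=> p q1 q2 q3 r z; ring.
rewrite [X in _ + _ * (_ - X + _)](Q_contract2 j s).
rewrite [X in _ + _ * (_ + X)](Q_contract2 s j) subr0 addr0.
congr (_ + _ * _).
  under eq_bigr do rewrite mulr_suml; rewrite exchange_big /=.
  by apply: eq_bigr => m _; rewrite mulr_sumr; apply: eq_bigr => k _; rewrite mulrA.
under eq_bigr do rewrite mulr_suml; rewrite exchange_big /=.
by apply: eq_bigr => m _; rewrite mulr_sumr; apply: eq_bigr => k _; rewrite mulrA.
Qed.

Lemma gamma_contract i j : \sum_k gamma L i j k u * y k =
  \sum_k G i j k * y k + (L u)^-1 * \sum_k cartan_up L i j k u * n_ k.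
Proof.
have -> : \sum_k gamma L i j k u * y k =
    \sum_s fund_inv L i s u * \sum_k low s j k * y k.
  under [RHS]eq_bigr do rewrite mulr_sumr.
  rewrite exchange_big /=; apply: eq_bigr => k _.
  rewrite /gamma mulr_sumr mulr_suml; apply: eq_bigr => s _.
  by rewrite /low; rewrite mulrCA !mulrA.
under eq_bigr do rewrite low_contract mulrDr.
rewrite big_split /=; congr (_ + _).
  under eq_bigr do rewrite mulr_sumr.
  rewrite exchange_big /= (bigD1 i)//= [X in _ + X]big1 ?addr0.
    under eq_bigr do rewrite mulrA.
    by rewrite -mulr_suml fund_invK// eqxx mul1r.
  move=> m mi; under eq_bigr do rewrite mulrA.
  by rewrite -mulr_suml fund_invK// eq_sym (negbTE mi) mul0r.
under eq_bigr do rewrite mulrCA; rewrite -mulr_sumr; congr (_ * _).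
under [LHS]eq_bigr do rewrite mulr_sumr; rewrite [LHS]exchange_big /=.
apply: eq_bigr => m _; rewrite /cartan_up mulr_suml; apply: eq_bigr => s _.
by rewrite mulrA.
Qed.

Let spray k := \sum_r \sum_s gamma L k r s u * u.2 0 r * u.2 0 s.

(** The Cartan term in the definition of N is killed by y. *)
Lemma nonlin_contract m : n_ m = spray m.
Proof.
rewrite /n_ /N /nonlin.
under eq_bigr do rewrite mulrBl; rewrite sumrB.
rewrite [X in _ - X](_ : _ = 0) ?subr0.
  apply: eq_bigr => r _; rewrite mulr_suml; apply: eq_bigr => s _.
  by rewrite mulrAC.
under eq_bigr do rewrite -mulrA mulr_suml.
rewrite -mulr_sumr exchange_big /= big1 ?mulr0// => k _.
under eq_bigr do rewrite mulrAC.
rewrite -mulr_suml [X in X * _](_ : _ = 0) ?mul0r//.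
under eq_bigr do rewrite mulr_suml.
rewrite exchange_big big1 //= => s _.
under eq_bigr do rewrite -mulrA.
by rewrite -mulr_sumr cartan_contract2// mulr0.
Qed.

(** By nonlin_contract, the Cartan term left over in gamma_contract is exactly the
    one that the definition of N subtracts. *)
Lemma chern_nonlin i j : nonlin L i j u = \sum_k Gam u i j k * u.2 0 k.
Proof.
rewrite /nonlin gamma_contract.
under [X in _ + _ * X]eq_bigr do rewrite nonlin_contract.
by rewrite addrK.
Qed.

(** Write L^2 = g_jk y^j y^k.  The given vector is horizontal since N = Gamma y,
    so the Chern equation expresses the derivative of g by Gamma, and these
    terms cancel those from the derivative of the factors y. *)
Lemma horizontal_sq xi :
  'D_((xi, - chr (Gam u) u.2 xi) : E * E) LL u = 0.
Proof.
set w := (xi, _) : (E * E)%type.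
pose C m j := conn_form (Gam u) xi m j.
pose c m := \sum_j C m j * y j.
have w2 m : w.2 0 m = - c m.
  rewrite !mxE; congr (- _); apply: eq_bigr => j _.
  by rewrite mulr_suml; apply: eq_bigr => k _; rewrite mulrAC.
have dg i j : 'D_w (fund L i j) u = \sum_m g m j * C m i + \sum_m g i m * C m j.
  have := Gam_chern i j w; rewrite [X in _ = 2 * X]big1 ?mulr0; last first.
    move=> k _; rewrite [delta_y _ _ _ _](_ : _ = 0) ?mul0r ?mulr0//.
    rewrite /delta_y w2 addrC; apply/eqP; rewrite subr_eq0; apply/eqP.
    under eq_bigr do rewrite chern_nonlin mulr_suml.
    rewrite exchange_big /=; apply: eq_bigr => r _.
    rewrite mulr_suml; apply: eq_bigr => l _.
    by rewrite GamC mulrAC.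
  move=> /eqP; rewrite /cov_metric !subr_eq add0r => /eqP ->.
  by rewrite addrC.
have dF j k : differentiable (fund L j k) u by exact: differentiable_fund.
pose I j (v : (E * E)%type) := \sum_k fund L j k v * v.2 0 k.
have dI j : differentiable (I j) u /\
    'D_w (I j) u = \sum_k ('D_w (fund L j k) u * y k + g j k * - c k).
  have [h1 h2] := contract_diff w (dF j); split=> //.
  by rewrite h2; apply: eq_bigr => k _; rewrite w2.
have -> : 'D_w LL u = 'D_w (fun v => \sum_j I j v * v.2 0 j) u.
  apply: near_eq_derive; apply: (open_near U_open Uu) => v Uv.
  exact/esym/fund_contract2.
have [_ ->] := contract_diff w (fun j => (dI j).1).
(* Four families of terms appear: C acts on the second index of g in the second
   and third, which cancel, and on the first index in the first and fourth. *)
transitivity (\sum_j (\sum_k (\sum_m g m k * C m j) * y k * y j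
   + (\sum_k (\sum_m g j m * C m k) * y k * y j - \sum_k g j k * c k * y j)
   - \sum_k g j k * y k * c j)).
  apply: eq_bigr => j _; rewrite (dI j).2 w2 mulrN; congr (_ - _).
    rewrite mulr_suml -sumrB -big_split; apply: eq_bigr => k _ /=.
    rewrite dg -/(y j).
    move: (\sum_m g m k * C m j) (\sum_m g j m * C m k) (y k) (y j) (g j k) (c k).
    by move=> a b yk yj gjk ck; ring.
  by rewrite mulr_suml.
transitivity (\sum_j (\sum_k (\sum_m g m k * C m j) * y k * y j
   - \sum_k g j k * y k * c j)).
  apply: eq_bigr => j _; congr (_ + _).
  rewrite [X in _ + X](_ : _ = 0) ?addr0//; apply/eqP; rewrite subr_eq0; apply/eqP.
  rewrite -!mulr_suml; congr (_ * _).
  under eq_bigr do rewrite mulr_suml; rewrite exchange_big /=.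
  apply: eq_bigr => m _; rewrite mulr_sumr; apply: eq_bigr => k _.
  by rewrite mulrA.
rewrite sumrB; apply/eqP; rewrite subr_eq0; apply/eqP.
transitivity (\sum_m \sum_k \sum_j g m k * C m j * y k * y j).
  rewrite exchange_big [RHS]exchange_big; apply: eq_bigr => k _ /=.
  rewrite [RHS]exchange_big; apply: eq_bigr => j _ /=.
  by rewrite !mulr_suml.
apply: eq_bigr => m _; apply: eq_bigr => k _; rewrite mulr_sumr.
by apply: eq_bigr => j _; rewrite [RHS]mulrA (mulrAC (g m k)).
Qed.

End ChernConnection.

(** If Gamma depends on x only, then N^i_j = Gamma^i_jk y^k is linear in y and its
    derivative with respect to y^k is Gamma^i_jk. *)
Lemma chern_berwald_coef (Gam : E * E -> coef3 (R := R) (n := n)) :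
  (forall u, U u -> forall i j k, Gam u i j k = Gam u i k j) ->
  (forall u, U u -> forall i j w, cov_metric Gam (fund L) i j u w =
    2 * \sum_k cartan L i j k u * (delta_y L k u w / L u)) ->
  (forall u v, U u -> U v -> u.1 = v.1 -> Gam u = Gam v) ->
  forall u i j k, U u -> berwald_coef L u i j k = Gam u i j k.
Proof.
move=> GamC Gam_chern Gam_y u i j k Uu.
pose f (v : (E * E)%type) := \sum_l Gam u i j l * v.2 0 l.
have -> : Gam u i j k = dy k f u.
  rewrite dy_contract//= big1 ?add0r// => l _.
  by rewrite [X in X * _]derive_cst mul0r.
(* N agrees with f on the fibre through u only. *)
rewrite /berwald_coef /dy derive_lineE [RHS]derive_lineE.
apply: near_eq_derive.
pose ln (s : R) := s *: ((0, delta_mx 0 k) : E * E) + u.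
have cl : ln s @[s --> 0] --> u.
  have -> : u = ln 0 by rewrite /ln scale0r add0r.
  by apply: cvgD; [exact: scalel_continuous|exact: cvg_cst].
have : \forall s \near 0, U (ln s) by apply: cl; exact: open_nbhs_nbhs.
apply: filterS => s Us.
have e1 : (ln s).1 = u.1 by rewrite /= scaler0 add0r.
have := chern_nonlin Us (GamC _ Us) (Gam_chern _ Us) i j.
by rewrite (Gam_y _ _ Us Uu e1).
Qed.

End MinkowskiNorms.

(** * Changes of chart *)

Section ChartChanges.
Context {R : realType} {n : nat} (M : smooth_manifold R n).
Local Notation E := 'rV[R]_n.
Local Notation cmap a := (chart_map (chart_of (a : atlas M))).
Local Notation cinv a := (chart_inv (chart_of (a : atlas M))).
Local Notation cdom a := (chart_dom (chart_of (a : atlas M))).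
Local Notation ccod a := (chart_cod (chart_of (a : atlas M))).
Local Notation ovl a b := (overlap (chart_of (a : atlas M)) (chart_of (b : atlas M))).
Local Notation trans a b :=
  (transition (chart_of (a : atlas M)) (chart_of (b : atlas M))).
Implicit Types (a b : atlas M) (p : M) (x y u v : E).

Lemma overlap_open a b : open (ovl a b).
Proof.
rewrite openE => x [ax bx]; apply: filterI.
  by apply: open_nbhs_nbhs; split => //; exact: chart_cod_open.
apply: (chart_inv_cts ax); apply: open_nbhs_nbhs; split => //.
exact: chart_dom_open.
Qed.

Lemma overlap_map a b p : cdom a p -> cdom b p -> ovl a b (cmap a p).
Proof. by move=> ap bp; split; [exact: chart_map_cod|rewrite chart_mapK]. Qed.

Lemma trans_map a b p : cdom a p -> trans a b (cmap a p) = cmap b p.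
Proof. by move=> ap; rewrite /transition chart_mapK. Qed.

Lemma overlap_trans a b c x : ovl a b x -> ovl a c x -> ovl b c (trans a b x).
Proof.
move=> [ax bx] [_ cx]; split; first exact: chart_map_cod.
by rewrite chart_mapK.
Qed.

Lemma trans_differentiable a b x : ovl a b x -> differentiable (trans a b) x.
Proof. exact: (transition_smooth a b 1).1. Qed.

Lemma derive_trans_differentiable a b x v : ovl a b x ->
  differentiable ('D_v (trans a b)) x.
Proof. exact: ((transition_smooth a b 2).2 v).1. Qed.

(** The chain rule: near x, the change of chart from a to c is the composite of
    those from a to b and from b to c. *)
Lemma derive_trans_comp a b c x v : ovl a b x -> ovl a c x ->
  'D_('D_v (trans a b) x) (trans b c) (trans a b x) = 'D_v (trans a c) x.
Proof.
move=> ab ac.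
rewrite -derive_chain; first last.
- by apply: trans_differentiable; exact: overlap_trans.
- exact: trans_differentiable.
apply: near_eq_derive.
have oab := @overlap_open a b.
apply: (open_near oab ab) => y [ay byy] /=.
by rewrite /transition chart_mapK.
Qed.

Lemma derive_trans_id a x v : ccod a x -> 'D_v (trans a a) x = v.
Proof.
move=> ax; rewrite -[RHS](derive_id x v); apply: near_eq_derive.
by apply: (open_near (@chart_cod_open _ _ _ _) ax) => y ay; rewrite /transition chart_invK.
Qed.

Lemma tcoord_trans a b p v : cdom a p -> cdom b p ->
  tcoord b p v = 'D_(tcoord a p v) (trans a b) (cmap a p).
Proof.
move=> ap bp; have cp := chart_at_dom p.
by rewrite /tcoord -(trans_map a cp) derive_trans_comp//; exact: overlap_map.
Qed.

Lemma tvecK a x y : ccod a x -> tcoord a (cinv a x) (tvec a x y) = y.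
Proof.
move=> ax; set p := cinv a x; have cp : cdom (chart_at p) p := chart_at_dom p.
have ap : cdom a p by exact: chart_inv_dom.
apply: etrans (derive_trans_id y ax).
by apply: (@derive_trans_comp a (chart_at p) a x y); split.
Qed.

Lemma tcoordK a p v : cdom a p -> tvec a (cmap a p) (tcoord a p v) = v.
Proof.
move=> ap; have cp := chart_at_dom p.
rewrite /tvec chart_mapK// /tcoord -(trans_map a cp) derive_trans_comp//.
- exact/derive_trans_id/chart_map_cod.
- exact: overlap_map.
- exact: overlap_map.
Qed.

Lemma tvec_differentiable a x : ccod a x ->
  differentiable (trans a (chart_at (cinv a x))) x.
Proof.
by move=> ax; apply: trans_differentiable; split => //; exact: chart_at_dom.
Qed.

Lemma tvecZ a x (k : R) v : ccod a x -> tvec a x (k *: v) = k *: tvec a x v.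
Proof. by move=> ax; exact: (derive_scalev _ _ (tvec_differentiable ax)). Qed.

Lemma tvec_sum a x (v : 'I_n -> E) : ccod a x ->
  tvec a x (\sum_i v i) = \sum_i tvec a x (v i).
Proof. by move=> ax; exact: (derive_sumv _ (tvec_differentiable ax)). Qed.

Lemma tcoord_neq0 a p v : cdom a p -> v != 0 -> tcoord a p v != 0.
Proof.
move=> ap; apply: contra_neq => v0.
by rewrite -(tcoordK v ap) v0 /tvec derive0.
Qed.

Lemma local_F_tcoord (F : M -> E -> R) a p v : cdom a p ->
  local_F F a (cmap a p, tcoord a p v) = F p v.
Proof. by move=> ap; rewrite /local_F /= tcoordK// chart_mapK. Qed.

Lemma local_metric_tvec h a x u v : riemannian h -> ccod a x ->
  h (cinv a x) (tvec a x u) (tvec a x v) =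
  \sum_i \sum_j local_metric h a i j x * u 0 i * v 0 j.
Proof.
move=> [hlin hsym _ _] ax.
have hr p w (I : finType) (k : I -> R) (z : I -> E) :
    h p w (\sum_i k i *: z i) = \sum_i k i * h p w (z i).
  pose fM := GRing.isLinear.Build _ _ _ _ _ (hlin p w).
  pose f : {scalar E} := HB.pack (h p w) fM.
  rewrite -[h p w]/(f : _ -> _) linear_sum; apply: eq_bigr => i _.
  exact: linearZ.
have te w : tvec a x w = \sum_i w 0 i *: tvec a x (delta_mx 0 i).
  rewrite [in LHS](row_sum_delta w) tvec_sum//; apply: eq_bigr => i _.
  exact: tvecZ.
rewrite (te v) hr exchange_big; apply: eq_bigr => j _ /=.
rewrite hsym (te u) hr mulr_sumr; apply: eq_bigr => i _.
rewrite hsym -/(local_metric h a i j x); move: (local_metric h a i j x) => g.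
by rewrite mulrCA mulrA mulrC mulrA.
Qed.

Lemma local_metric_tcoord h a p u v : riemannian h -> cdom a p ->
  h p u v = \sum_i \sum_j local_metric h a i j (cmap a p)
              * tcoord a p u 0 i * tcoord a p v 0 j.
Proof.
move=> hr ap.
have := local_metric_tvec (tcoord a p u) (tcoord a p v) hr (chart_map_cod ap).
rewrite (chart_mapK ap) (tcoordK u ap) (tcoordK v ap) => h_eq; exact: h_eq.
Qed.

Lemma slit_open a : open (slit a).
Proof.
have -> : slit a = (fst @^-1` ccod a) `&` (snd @^-1` [set y : E | y != 0]).
  by apply/seteqP; split.
apply: openI; apply: open_comp.
- by move=> x _; exact: cvg_fst.
- exact: chart_cod_open.
- by move=> x _; exact: cvg_snd.
have -> : [set y : E | y != 0] = ~` [set 0].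
  by apply/seteqP; split => y /=; [move/eqP|move=> ?; apply/eqP].
by apply: closed_openC; apply: accessible_closed_set1; exact: hausdorff_accessible.
Qed.

Lemma local_F_hom F a (u : (E * E)%type) (l : R) : finsler F -> slit a u -> 0 < l ->
  local_F F a (u.1, l *: u.2) = l * local_F F a u.
Proof. by move=> [_ _ Fh _] [au _] l0; rewrite /local_F /= tvecZ// Fh. Qed.

End ChartChanges.

(** * The Levi-Civita connection is the Chern connection *)

Section LeviCivitaIsChern.
Context {R : realType} {n : nat} (M : smooth_manifold R n).
Local Notation E := 'rV[R]_n.
Local Notation ccod a := (chart_cod (chart_of (a : atlas M))).
Local Notation cinv a := (chart_inv (chart_of (a : atlas M))).

(** The difference T of two torsion-free connections compatible with g, with its
    upper index lowered, is symmetric in the last two indices and antisymmetric in the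
    first two; such a tensor is zero, as six alternating exchanges show. *)
Lemma torsion_free_metric_unique (T : 'I_n -> 'I_n -> 'I_n -> R)
    (g : 'I_n -> 'I_n -> R) :
  (forall i j, g i j = g j i) ->
  (forall v : E, \sum_i \sum_j g i j * v 0 i * v 0 j = 0 -> v = 0) ->
  (forall i j k, T i j k = T i k j) ->
  (forall i j l, \sum_m g m j * T m i l + \sum_m g i m * T m j l = 0) ->
  forall i j k, T i j k = 0.
Proof.
move=> gC g0 TC Tg.
pose t j i l := \sum_m g m j * T m i l.
have tC j i l : t j i l = t j l i by apply: eq_bigr => m _; rewrite TC.
have tA j i l : t j i l = - t i j l.
  apply/eqP; rewrite -addr_eq0 -[X in _ == X](Tg i j l); apply/eqP.
  by congr (_ + _); apply: eq_bigr => m _; rewrite gC.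
have t0 j i l : t j i l = 0.
  have e : t j i l = - t j i l.
    by rewrite {1}(tA j i l) (tC i j l) (tA i l j) (tC l i j) (tA l j i) opprK (tC j l i).
  apply/eqP; have := e; move/eqP; rewrite -addr_eq0 -mulr2n.
  by rewrite mulrn_eq0.
move=> i j k; pose v : E := \row_m T m j k.
suff /rowP/(_ i) : v = 0 by rewrite !mxE.
apply: g0; rewrite exchange_big big1 //= => l _.
rewrite -mulr_suml; under eq_bigr do rewrite mxE.
by have := t0 l j k; rewrite /t => ->; rewrite mul0r.
Qed.

Context (F : M -> E -> R) (h : M -> E -> E -> R) (D : lin_conn M)
  (Dc : pullback_conn M).
Hypothesis F_finsler : finsler F.
Hypothesis Dc_chern : chern F Dc.
Hypothesis Dc_y : forall a x y y', slit a (x, y) -> slit a (x, y') ->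
  pc_coef Dc a (x, y) = pc_coef Dc a (x, y').
Hypothesis h_riem : riemannian h.
Hypothesis h_par : berwald_parallel F h.
Hypothesis D_lc : levi_civita h D.

Lemma local_metricC a i j x : local_metric h a i j x = local_metric h a j i x.
Proof. by case: h_riem => _ hC _ _; exact: hC. Qed.

Lemma local_metric_definite a x (v : E) : ccod a x ->
  \sum_i \sum_j local_metric h a i j x * v 0 i * v 0 j = 0 -> v = 0.
Proof.
move=> ax; rewrite -(local_metric_tvec _ _ h_riem ax) => h0.
have [tv|tv] := eqVneq (tvec a x v) 0.
  by rewrite -(tvecK v ax) tv /tcoord derive0.
by have := riem_pos h_riem (cinv a x) tv; rewrite h0 ltxx.
Qed.

Lemma conn_form_delta (G : coef3 (R := R) (n := n)) l :
  conn_form G (delta_mx 0 l) = fun k i => G k i l.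
Proof.
by apply/funext => k; apply/funext => i; exact: (sum_delta (fun l => G k i l)).
Qed.

(** The hypothesis on h says that h is parallel for the linear Berwald connection,
    whose coefficients are those of the Chern connection by chern_berwald_coef.
    So the Chern and the Levi-Civita coefficients are both torsion-free and
    compatible with h. *)
Lemma levi_civita_chern a x y : slit a (x, y) ->
  forall i j k, lc_coef D a x i j k = pc_coef Dc a (x, y) i j k.
Proof.
move=> axy; have ax := axy.1.
have BG u : slit a u -> berwald_coef (local_F F a) u = pc_coef Dc a u.
  move=> au; do 3![apply/funext => ?]; move: au.
  apply: (@chern_berwald_coef R n (slit a) (local_F F a)).
  - exact: slit_open.
  - exact: (finsler_smooth F_finsler a).
  - by move=> v l; exact: local_F_hom.
  - by move=> v w; exact: (finsler_pos F_finsler).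
  - by move=> v av; exact: (Dc_chern av).1.
  - by move=> v av; exact: (Dc_chern av).2.
  - by move=> [v1 v2] [w1 w2] av aw /= e; rewrite -e in aw *; exact: Dc_y.
have [lcC lcg] := D_lc ax.
have [chC _] := Dc_chern axy.
move=> i j k; apply/eqP; rewrite -subr_eq0; apply/eqP; move: i j k.
apply: (@torsion_free_metric_unique
  (fun i j k => lc_coef D a x i j k - pc_coef Dc a (x, y) i j k)
  (fun i j => local_metric h a i j x)).
- by move=> i j; exact: local_metricC.
- by move=> v; exact: local_metric_definite.
- by move=> i j k; rewrite lcC chC.
move=> i j l.
have := h_par axy i j (delta_mx 0 l, 0).
rewrite /cov_metric derive_comp_fst /= (lcg i j (delta_mx 0 l)).
rewrite (BG _ axy) !conn_form_delta.
move=> H; rewrite -[RHS]H.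
under eq_bigr do rewrite mulrBr.
under [X in _ + X]eq_bigr do rewrite mulrBr.
by rewrite !sumrB addrACA !addrA.
Qed.

Lemma chr_eq (G G' : coef3 (R := R) (n := n)) (v xi : E) :
  (forall i j k, G i j k = G' i j k) -> chr G v xi = chr G' v xi.
Proof.
move=> GG; apply/rowP => i; rewrite !mxE.
by apply: eq_bigr => j _; apply: eq_bigr => k _; rewrite GG.
Qed.

Lemma local_F_sq_differentiable a u : slit a u ->
  differentiable (fun u => local_F F a u ^+ 2) u.
Proof.
move=> au.
by apply: (sq_Ck (@slit_open _ _ _ a) (finsler_smooth F_finsler a) 1).1.
Qed.

Lemma local_F_sq_horizontal a x y xi : slit a (x, y) ->
  'D_((xi, - chr (lc_coef D a x) y xi) : E * E) (fun u => local_F F a u ^+ 2) (x, y) = 0.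
Proof.
move=> axy; rewrite (chr_eq _ _ (levi_civita_chern axy)).
have [chC chg] := Dc_chern axy.
apply: (@horizontal_sq R n (slit a) (local_F F a) _ _ _ _ (pc_coef Dc a) (x, y)) => //.
- exact: slit_open.
- exact: (finsler_smooth F_finsler a).
- by move=> v l; exact: local_F_hom.
- by move=> v w; exact: (finsler_pos F_finsler).
Qed.

End LeviCivitaIsChern.

(** * Induction on intervals *)

Section IntervalInduction.
Context {R : realType}.
Implicit Types (t p q a b : R) (S : seq R).

(** To prove Q a b for a predicate Q that is additive on adjacent intervals, it
    suffices to prove it on all short intervals to the left and to the right of each
    point: the supremum of the t with Q a t satisfies Q and cannot be less
    than b.  Asking for one-sided intervals only allows the behaviour to change
    at every point. *)
Lemma interval_ind (a b : R) (Q : R -> R -> Prop) : a <= b ->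
  Q a a ->
  (forall p q r, a <= p -> p <= q -> q <= r -> r <= b -> Q p q -> Q q r -> Q p r) ->
  (forall t, a <= t <= b -> exists2 d, 0 < d &
    (forall p, a <= p -> t - d < p -> p < t -> Q p t) /\
    (forall q, q <= b -> t < q -> q < t + d -> Q t q)) ->
  Q a b.
Proof.
move=> ab Qaa Qtrans Qloc.
pose A : set R := [set t | a <= t <= b /\ Q a t].
have Aa : A a by split; rewrite ?lexx.
have ubA : ubound A b by move=> t [/andP[]].
have hsA : has_sup A by split; [exists a|exists b].
pose s := sup A.
have as_ : a <= s by apply: sup_upper_bound.
have sb : s <= b by apply: ge_sup => //; exists a.
have [|d d0 [Ql Qr]] := Qloc s; first by rewrite as_ sb.
have Qs : Q a s.
  have [p [/andP[ap pb] Qp] sp] := sup_adherent d0 hsA.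
  have ps : p <= s by apply: sup_upper_bound => //; split=> //; rewrite ap pb.
  have [<-//|nps] := eqVneq p s.
  apply: (Qtrans a p s) => //; apply: Ql => //.
  by rewrite lt_neqAle nps.
have [<-//|nsb] := eqVneq s b.
have sb' : s < b by rewrite lt_neqAle nsb.
pose q := Num.min b (s + d / 2).
have sq : s < q by rewrite lt_min sb' ltrDl divr_gt0.
have qd : q < s + d.
  rewrite /q gt_min; apply/orP; right.
  by rewrite ltrD2l ltr_pdivrMr// ltr_pMr// ltr1n.
have qb : q <= b by rewrite ge_min lexx.
have : q <= s.
  apply: sup_upper_bound => //; split; first by rewrite qb (le_trans as_ (ltW sq)).
  by apply: (Qtrans a s q) => //; [exact: ltW|exact: Qr].
by rewrite leNgt sq.
Qed.

Lemma isolate_seq S t : exists2 d, 0 < d &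
  forall s, s \in S -> s != t -> d <= `|s - t|.
Proof.
elim: S => [|s S [d d0 IH]]; first by exists 1.
have [->|st] := eqVneq s t.
  exists d => // r; rewrite inE => /predU1P[->|]; first by rewrite eqxx.
  exact: IH.
exists (Num.min d `|s - t|); first by rewrite lt_min d0 normr_gt0 subr_eq0.
move=> r; rewrite inE => /predU1P[->|rS] rt; first by rewrite ge_min lexx orbT.
by rewrite ge_min IH.
Qed.

Lemma notin_near S (t d r : R) : (forall s, s \in S -> s != t -> d <= `|s - t|) ->
  r != t -> `|r - t| < d -> r \notin S.
Proof. by move=> H rt rd; apply/negP => /H /(_ rt); rewrite leNgt rd. Qed.

Lemma constant_of_derive0 (f : R -> R) a b S : a <= b ->
  {within `[a, b], continuous f} ->
  (forall t, a < t < b -> t \notin S -> is_derive t 1 f 0) ->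
  f a = f b.
Proof.
move=> ab cf df.
apply: (@interval_ind a b (fun p q => f p = f q)) => //.
  by move=> p q r _ _ _ _ -> ->.
have step p q : a <= p -> p < q -> q <= b ->
    (forall r, p < r < q -> r \notin S) -> f p = f q.
  move=> ap pq qb pqS.
  have [r||c _ e] := @MVT R f (fun=> 0) p q pq.
  - rewrite in_itv /= => /andP[pr rq]; apply: df.
      by rewrite (le_lt_trans ap pr) (lt_le_trans rq qb).
    by apply: pqS; rewrite pr rq.
  - apply: continuous_subspaceW cf; apply: subset_itvScc; first exact: ap.
    exact: qb.
  by apply/eqP; rewrite eq_sym -subr_eq0 e mul0r.
move=> t /andP[at_ tb]; have [d d0 Sd] := isolate_seq S t.
exists d => //; split=> r hr r1 r2.
  apply: step => // s /andP[rs st]; apply: (notin_near Sd); first by rewrite lt_eqF.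
  rewrite ltr0_norm ?subr_lt0// opprB ltrBlDr -ltrBlDl.
  exact: lt_trans rs.
apply: step => // s /andP[rs st]; apply: (notin_near Sd); first by rewrite gt_eqF.
rewrite gtr0_norm ?subr_gt0// ltrBlDl.
exact: lt_trans r2.
Qed.

End IntervalInduction.

(** * Derivatives along curves *)

Section Curves.
Context {R : realType} {n : nat}.
Local Notation E := 'rV[R]_n.

Lemma is_derive_row (W : R -> E) (t : R) (dW : E) :
  is_derive t 1 W dW <-> forall i, is_derive t 1 (fun s => W s 0 i) (dW 0 i).
Proof.
split=> [[/[dup] dv /derivable_mxP d <-] i|d].
  by split; [exact: d|rewrite (derive_mx dv) mxE].
have dv : derivable W t 1.
  by apply/derivable_mxP => i j; rewrite ord1; have [] := d j.
split=> //; rewrite (derive_mx dv); apply/rowP => i; rewrite mxE.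
by have [_ ->] := d i.
Qed.

Lemma is_derive_pair {V W : normedModType R} (f : R -> V) (g : R -> W) (t : R) df dg :
  is_derive t 1 f df -> is_derive t 1 g dg ->
  is_derive t 1 (fun s => (f s, g s)) (df, dg).
Proof.
move=> [/derivable1_diffP ft <-] [/derivable1_diffP gt <-].
have d := differentiable_pair ft gt.
split; first exact/derivable1_diffP.
by rewrite (deriveE _ d) (diff_pair ft gt) (deriveE _ ft) (deriveE _ gt).
Qed.

Lemma is_derive_bigsum (f : 'I_n -> R -> R) (t : R) (df : 'I_n -> R) :
  (forall i, is_derive t 1 (f i) (df i)) ->
  is_derive t 1 (fun s => \sum_i f i s) (\sum_i df i).
Proof.
move=> d; have -> : (fun s => \sum_i f i s) = \sum_i f i.
  by apply/funext => s; rewrite fct_sumE.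
exact: is_derive_sum.
Qed.

Lemma cvg_bigsum {T : Type} (F : set_system T) {FF : Filter F}
  (f : 'I_n -> T -> R) (l : 'I_n -> R) :
  (forall i, f i x @[x --> F] --> l i) ->
  (\sum_i f i x) @[x --> F] --> \sum_i l i.
Proof.
move=> H; elim: (index_enum _) => [|i r IH].
  by rewrite big_nil; under eq_fun do rewrite big_nil; exact: cvg_cst.
rewrite big_cons; under eq_fun do rewrite big_cons.
exact: cvgD.
Qed.

Lemma is_derive_mul (f g : R -> R) (t df dg : R) :
  is_derive t 1 f df -> is_derive t 1 g dg ->
  is_derive t 1 (fun s => f s * g s) (df * g t + f t * dg).
Proof.
move=> hf hg; apply: is_derive_eq (is_deriveM hf hg) _.
by rewrite addrC mulrC.
Qed.

(** The derivative of h(U, V) along a path, for parallel U and V, is this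
    sum with g = h and C^k_i = Gamma^k_il xi^l: compatibility of the connection with h
    gives the derivative of h in terms of C, and the parallel equation those of U and
    V. *)
Lemma metric_leibniz (g C : 'I_n -> 'I_n -> R) (u v : E) :
  \sum_i \sum_j ((((\sum_k g k j * C k i + \sum_k g i k * C k j) * u 0 i
     + g i j * - (\sum_k C i k * u 0 k)) * v 0 j)
     + g i j * u 0 i * - (\sum_k C j k * v 0 k)) = 0.
Proof.
pose T1 := \sum_i \sum_j \sum_k g i j * C i k * u 0 k * v 0 j.
pose T2 := \sum_i \sum_j \sum_k g i j * C j k * v 0 k * u 0 i.
transitivity (T1 + T2 - T1 - T2); last by rewrite (addrC T1) addrK subrr.
have -> : \sum_i \sum_j ((((\sum_k g k j * C k i + \sum_k g i k * C k j) * u 0 i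
     + g i j * - (\sum_k C i k * u 0 k)) * v 0 j)
     + g i j * u 0 i * - (\sum_k C j k * v 0 k)) =
  \sum_i \sum_j \sum_k g k j * C k i * u 0 i * v 0 j
  + \sum_i \sum_j \sum_k g i k * C k j * v 0 j * u 0 i - T1 - T2.
  rewrite /T1 /T2 -big_split -!sumrB /=; apply: eq_bigr => i _.
  rewrite -big_split -!sumrB /=; apply: eq_bigr => j _.
  rewrite mulrN mulrDl mulrN mulNr mulrDl mulrDl; congr (_ + _ - _ - _).
  - by rewrite !mulr_suml.
  - by rewrite !mulr_suml; apply: eq_bigr => k _; rewrite mulrAC.
  - rewrite mulr_sumr mulr_suml; apply: eq_bigr => k _; by rewrite mulrA.
  - rewrite mulr_sumr; apply: eq_bigr => k _; rewrite mulrA [in RHS]mulrAC.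
    by rewrite -!mulrA; congr (_ * _); rewrite !mulrA; congr (_ * _); exact: mulrC.
congr (_ + _ - _ - _); rewrite /T1 /T2.
  rewrite exchange_big [RHS]exchange_big; apply: eq_bigr => j _ /=.
  by rewrite exchange_big.
by apply: eq_bigr => i _; rewrite exchange_big.
Qed.

End Curves.

(** * Quantities preserved by parallel fields *)

Section ParallelFields.
Context {R : realType} {n : nat} (M : smooth_manifold R n).
Local Notation E := 'rV[R]_n.
Local Notation cmap a := (chart_map (chart_of (a : atlas M))).
Local Notation cinv a := (chart_inv (chart_of (a : atlas M))).
Local Notation cdom a := (chart_dom (chart_of (a : atlas M))).
Local Notation ccod a := (chart_cod (chart_of (a : atlas M))).
Context (D : lin_conn M) (c : R -> M).

(** Parallel fields on a part of the path, with their exceptional points as a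
    parameter: this is the form that can be glued. *)
Definition parallel_on (S : seq R) (p q : R) (V : R -> E) : Prop :=
  forall a (t : R), t \in `[p, q] -> cdom a (c t) ->
    let Va (s : R) := tcoord a (c s) (V s) in
    Va s @[s --> within `[p, q] (nbhs t)] --> Va t /\
    (t \in `]p, q[ -> t \notin S ->
       is_derive t 1 Va (- chr (lc_coef D a (cmap a (c t))) (Va t)
                               ('D_1 (cmap a \o c) t))).

Lemma parallelP V : parallel D c V <-> exists S, parallel_on S 0 1 V.
Proof.
split=> -[S par]; exists S => a t t01 act; have [h1 h2] := par a t t01 act.
  split; first exact: h1.
  move=> t01' tS; have [dV eV] := h2 t01' tS.
  split; first exact: dV.
  by move: eV; rewrite !derive1E.
split; first exact: h1.
move=> t01' tS; have [dV eV] := h2 t01' tS.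
split; first exact: dV.
by rewrite !derive1E.
Qed.

Context (S' : seq R).
Hypothesis c_cont : {within `[0%R, 1%R], continuous c}.
Hypothesis c_C1 : forall a (t : R), t \in `[0, 1] -> cdom a (c t) ->
    [/\ t \in `]0, 1[ -> t \notin S' ->
          derivable (cmap a \o c) t 1 /\
          {for t, continuous (derive1 (cmap a \o c))},
        t < 1 -> cvg (derive1 (cmap a \o c) s @[s --> t^'+])
      & 0 < t -> cvg (derive1 (cmap a \o c) s @[s --> t^'-])].

Lemma path_cvg (t : R) : t \in `[0, 1] -> c s @[s --> within `[0%R, 1%R] (nbhs t)] --> c t.
Proof. by move=> t01; move/subspace_continuousP: c_cont; apply. Qed.

Lemma path_near_chart a (t : R) : t \in `[0, 1] -> cdom a (c t) ->
  \forall s \near within `[0%R, 1%R] (nbhs t), cdom a (c s).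
Proof.
move=> t01 act; apply: (path_cvg t01); apply: open_nbhs_nbhs; split => //.
exact: chart_dom_open.
Qed.

Lemma path_chart_cvg a (t : R) : t \in `[0, 1] -> cdom a (c t) ->
  cmap a (c s) @[s --> within `[0%R, 1%R] (nbhs t)] --> cmap a (c t).
Proof.
move=> t01 act; apply: cvg_comp (path_cvg t01) _.
exact: (chart_map_cts act).
Qed.

Lemma near_inner (t : R) (P : R -> Prop) : t \in `]0, 1[ ->
  (\forall s \near within `[0%R, 1%R] (nbhs t), P s) -> \forall s \near t, P s.
Proof.
move=> t01; rewrite near_withinE => H.
have : \forall s \near t, s \in `]0%R, 1%R[ by exact: near_in_itvoo.
by apply: filterS2 H => s + s01; apply; exact: subset_itv_oo_cc.
Qed.

(** A function on the path can be studied through its expressions g a in the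
    charts, which agree with it near every point. *)
Lemma constant_along_path (f : R -> R) (g : atlas M -> R -> R) (S : seq R) :
  (forall a s, cdom a (c s) -> f s = g a s) ->
  (forall a s, s \in `[0, 1] -> cdom a (c s) ->
     g a r @[r --> within `[0%R, 1%R] (nbhs s)] --> g a s) ->
  (forall a s, s \in `]0, 1[ -> s \notin S -> cdom a (c s) ->
     is_derive s 1 (g a) 0) ->
  forall t, t \in `[0, 1] -> f t = f 0.
Proof.
move=> fg cg dg t t01.
have [t0 t1] : 0 <= t /\ t <= 1 by move: t01; rewrite in_itv /= => /andP.
apply/esym/(@constant_of_derive0 _ f 0 t S t0).
  suff cf : {within `[0, 1], continuous f}.
    apply: continuous_subspaceW cf; apply: subset_itvScc; first exact: lexx.
    exact: t1.
  apply/subspace_continuousP => s s01; pose a := chart_at (c s).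
  have acs : cdom a (c s) by exact: chart_at_dom.
  rewrite /from_subspace (fg a s acs).
  have nc := path_near_chart s01 acs.
  apply: cvg_trans (near_eq_cvg _) (cg a s s01 acs).
  by apply: filterS nc => r acr; exact/esym/(fg a r acr).
move=> s /andP[s0 st] sS.
have s01' : s \in `]0, 1[ by rewrite in_itv /= s0 (lt_le_trans st t1).
have s01 : s \in `[0, 1] by exact: subset_itv_oo_cc.
pose a := chart_at (c s).
have acs : cdom a (c s) by exact: chart_at_dom.
have := near_inner s01' (path_near_chart s01 acs).
move=> /(filterS (fun r acr => esym (fg a r acr))) /near_eq_is_derive; apply.
exact: dg.
Qed.

Lemma path_is_derive a s : s \in `]0, 1[ -> s \notin S' -> cdom a (c s) ->
  is_derive s 1 (cmap a \o c) ('D_1 (cmap a \o c) s).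
Proof.
move=> s01 sS' acs.
by have [/(_ s01 sS')[dc _] _ _] := c_C1 (subset_itv_oo_cc s01) acs.
Qed.

Lemma parallel_metric h S1 S2 U V : riemannian h -> levi_civita h D ->
  parallel_on S1 0 1 U -> parallel_on S2 0 1 V ->
  forall t, t \in `[0, 1] -> h (c t) (U t) (V t) = h (c 0) (U 0) (V 0).
Proof.
move=> h_riem D_lc parU parV.
apply: (@constant_along_path (fun s => h (c s) (U s) (V s))
  (fun a s => \sum_i \sum_j local_metric h a i j (cmap a (c s))
      * tcoord a (c s) (U s) 0 i * tcoord a (c s) (V s) 0 j) (S' ++ S1 ++ S2)).
- by move=> a s acs; exact: local_metric_tcoord.
- move=> a s s01 acs; apply: cvg_bigsum => i; apply: cvg_bigsum => j.
  have [cU _] := parU a s s01 acs; have [cV _] := parV a s s01 acs.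
  apply: cvgM; last first.
    by apply: (cvg_comp _ (fun v : E => v 0 j) cV); exact: coord_continuous.
  apply: cvgM; last first.
    by apply: (cvg_comp _ (fun v : E => v 0 i) cU); exact: coord_continuous.
  apply: (cvg_comp _ (local_metric h a i j) (path_chart_cvg s01 acs)).
  apply: differentiable_continuous.
  by apply: (riem_smooth h_riem a i j 1).1; exact: chart_map_cod.
move=> a s s01'; rewrite !mem_cat !negb_or => /and3P[sS' sS1 sS2] acs.
have s01 : s \in `[0, 1] by exact: subset_itv_oo_cc.
have dc := path_is_derive s01' sS' acs.
have [_ /(_ s01' sS1) dU] := parU a s s01 acs.
have [_ /(_ s01' sS2) dV] := parV a s s01 acs.
set x := cmap a (c s) in dU dV; set xi := 'D_1 (cmap a \o c) s in dc dU dV.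
have ax : ccod a x by exact: chart_map_cod.
pose C := conn_form (lc_coef D a x) xi.
have chrE v i : (- chr (lc_coef D a x) v xi) 0 i = - \sum_k C i k * v 0 k.
  rewrite !mxE; congr (- _); apply: eq_bigr => k _.
  by rewrite mulr_suml; apply: eq_bigr => l _; rewrite mulrAC.
have dg i j : is_derive s 1 (fun r => local_metric h a i j (cmap a (c r)))
   (\sum_k local_metric h a k j x * C k i + \sum_k local_metric h a i k x * C k j).
  rewrite -(D_lc a x ax).2; apply: (is_derive_curve dc).
  exact: (riem_smooth h_riem a i j 1).1.
have dUi i := is_derive_eq ((is_derive_row _ _ _).1 dU i) (chrE _ i).
have dVi i := is_derive_eq ((is_derive_row _ _ _).1 dV i) (chrE _ i).
apply: (is_derive_eq _ (metric_leibniz (fun i j => local_metric h a i j x) C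
  (tcoord a (c s) (U s)) (tcoord a (c s) (V s)))).
apply: is_derive_bigsum => i; apply: is_derive_bigsum => j.
exact: (is_derive_mul (is_derive_mul (dg i j) (dUi i)) (dVi j)).
Qed.

(** The pair (c, V) moves in a horizontal direction, in which F^2 has
    derivative zero.  The field must not vanish because F^2 is only
    differentiable away from the zero section. *)
Lemma parallel_finsler F S1 V :
  (forall a u, slit a u -> differentiable (fun v => local_F F a v ^+ 2) u) ->
  (forall a x y xi, slit a (x, y) ->
    'D_((xi, - chr (lc_coef D a x) y xi) : E * E)
       (fun v => local_F F a v ^+ 2) (x, y) = 0) ->
  parallel_on S1 0 1 V -> (forall t, t \in `[0, 1] -> V t != 0) ->
  forall t, t \in `[0, 1] -> F (c t) (V t) ^+ 2 = F (c 0) (V 0) ^+ 2.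
Proof.
move=> Fdiff Fhor parV V0.
have aV a s : s \in `[0, 1] -> cdom a (c s) ->
    slit a (cmap a (c s), tcoord a (c s) (V s)).
  move=> s01 acs; split; first exact: chart_map_cod.
  by apply: tcoord_neq0 => //; exact: V0.
apply: (@constant_along_path (fun s => F (c s) (V s) ^+ 2)
  (fun a s => local_F F a (cmap a (c s), tcoord a (c s) (V s)) ^+ 2) (S' ++ S1)).
- by move=> a s acs; rewrite local_F_tcoord.
- move=> a s s01 acs; have [cV _] := parV a s s01 acs.
  apply: (@cvg_comp _ _ _ (fun r => (cmap a (c r), tcoord a (c r) (V r)))
    (fun v => local_F F a v ^+ 2) _ (nbhs (cmap a (c s), tcoord a (c s) (V s)))).
    exact: (cvg_pair (path_chart_cvg s01 acs) cV).
  exact: (differentiable_continuous (Fdiff _ _ (aV a s s01 acs))).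
move=> a s s01'; rewrite !mem_cat !negb_or => /andP[sS' sS1] acs.
have s01 : s \in `[0, 1] by exact: subset_itv_oo_cc.
have [_ /(_ s01' sS1) dV] := parV a s s01 acs.
have dcV := is_derive_pair (path_is_derive s01' sS' acs) dV.
apply: (is_derive_eq (is_derive_curve dcV (Fdiff _ _ (aV a s s01 acs)))).
exact: Fhor (aV a s s01 acs).
Qed.

End ParallelFields.

(** * Linear differential equations *)

Section LinearODE.
Context {R : realType} {n : nat}.
Local Notation E := 'rV[R]_n.

Lemma antiderivative (f : R -> R) (a b : R) : a < b -> continuous f ->
  exists J : R -> R, forall t, a < t < b -> is_derive t 1 J (f t).
Proof.
move=> ab cf.
exists (fun x => \int[@lebesgue_measure R]_(t in [set` `[a, x]]) f t)%R.
move=> t /andP[at_ tb].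
have fi : (@lebesgue_measure R).-integrable `[a, b] (EFin \o f).
  apply: continuous_compact_integrable; first exact: segment_compact.
  exact: continuous_subspaceT.
have [d1 d2] := continuous_FTC1_closed tb fi at_ (cf t).
by split; [exact: d1|rewrite -derive1E; exact: d2].
Qed.

Lemma norm_row_le (v : E) (r : R) : 0 <= r -> (forall j, `|v 0 j| <= r) -> `|v| <= r.
Proof.
move=> r0 H; rewrite [leLHS]/Num.Def.normr/= mx_normrE.
by apply: bigmax_le => // -[i j] _ /=; rewrite ord1.
Qed.

Lemma norm_coord_le (v : E) j : `|v 0 j| <= `|v|.
Proof.
rewrite [leRHS]/Num.Def.normr/= mx_normrE.
exact: (le_bigmax _ (fun i : 'I_1 * 'I_n => `|v i.1 i.2|) (0, j)).
Qed.

Lemma geometric_small (C e : R) : 0 < e -> exists k, C / 2 ^+ k < e.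
Proof.
move=> e0; have : geometric C 2^-1 k @[k --> \oo] --> (0 : R).
  by apply: cvg_geometric; rewrite ger0_norm ?invr_ge0// invf_lt1// ltr1n.
move=> /cvgrPdist_lt /(_ e e0) [k _ /(_ k (leqnn k))] /=.
by rewrite sub0r normrN => H; exists k; rewrite -exprVn (le_lt_trans (ler_norm _)).
Qed.

Lemma geometric_limit (u : nat -> E) (C : R) : 0 <= C ->
  (forall k, `|u k.+1 - u k| <= C / 2 ^+ k.+1) ->
  exists l, forall k, `|l - u k| <= C / 2 ^+ k.
Proof.
move=> C0 Hu.
have P k m : `|u (k + m)%N - u k| <= C / 2 ^+ k - C / 2 ^+ (k + m).
  elim: m => [|m IH]; first by rewrite addn0 !subrr normr0.
  rewrite addnS -(subrKA (u (k + m)%N)) (le_trans (ler_normD _ _))//.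
  have -> : C / 2 ^+ k - C / 2 ^+ (k + m).+1 =
     C / 2 ^+ (k + m).+1 + (C / 2 ^+ k - C / 2 ^+ (k + m)).
    have -> : C / 2 ^+ (k + m) = 2 * (C / 2 ^+ (k + m).+1).
      by rewrite exprS invfM [RHS]mulrCA mulVKf ?pnatr_eq0.
    by move: (C / 2 ^+ k) (C / 2 ^+ (k + m).+1) => a x; ring.
  exact: lerD.
have P2 k m : (k <= m)%N -> `|u m - u k| <= C / 2 ^+ k.
  move=> km; rewrite -(subnKC km) (le_trans (P _ _))//.
  by rewrite gerBl divr_ge0// exprn_ge0.
have cu : cvg (u k @[k --> \oo]).
  apply: cauchy_cvg; apply: cauchy_exP => e e0.
  have [k ke] := geometric_small C e0; exists (u k).
  exists k => // m /= km; rewrite -ball_normE /ball_ /= distrC.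
  exact: le_lt_trans (P2 k m km) ke.
exists (lim (u k @[k --> \oo])) => k.
apply/ler_addgt0Pr => e e0.
have /cvgrPdist_lt /(_ e e0) [m _ Hm] := cu.
have /= := Hm (maxn k m) (leq_maxr k m).
set l := lim _ => lm.
rewrite -(subrKA (u (maxn k m))) (le_trans (ler_normD _ _))// addrC lerD//.
  by apply: P2; exact: leq_maxl.
exact: ltW.
Qed.

(** The retraction of the line onto [lo, hi]: composing with it extends to the whole
    line, with the same bounds, what is only controlled on [lo, hi]. *)
Definition clamp (lo hi t : R) : R := Num.max lo (Num.min hi t).

Lemma clamp_continuous lo hi : continuous (clamp lo hi).
Proof.
move=> t; apply: (@continuous_max _ _ (cst lo) (fun t => Num.min hi t)).
  exact: cvg_cst.
by apply: (@continuous_min _ _ (cst hi) id); [exact: cvg_cst|exact: cvg_id].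
Qed.

Lemma clamp_itv lo hi t : lo <= hi -> lo <= clamp lo hi t <= hi.
Proof. by move=> lh; rewrite /clamp le_max lexx /= ge_max lh ge_min lexx. Qed.

Lemma clamp_id lo hi t : lo <= t <= hi -> clamp lo hi t = t.
Proof. by move=> /andP[lt th]; rewrite /clamp (min_idPr th) (max_idPr lt). Qed.

Lemma cvg_row {T : Type} (F : set_system T) {FF : Filter F} (f : T -> E) (l : E) :
  (forall j, f x 0 j @[x --> F] --> l 0 j) -> f x @[x --> F] --> l.
Proof.
move=> H; apply/cvgrPdist_le => e e0.
have : \forall x \near F, forall j, `|l 0 j - f x 0 j| <= e.
  apply: filter_forall => j.
  by have /cvgrPdist_le /(_ e e0) := H j.
apply: filterS => x Hx; apply: norm_row_le; first exact: ltW.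
by move=> j; rewrite !mxE.
Qed.

Lemma mean_value_bound (f df : R -> R) (lo hi M s t : R) :
  (forall r, lo <= r <= hi -> is_derive r 1 f (df r) /\ `|df r| <= M) ->
  lo <= s <= hi -> lo <= t <= hi -> `|f t - f s| <= M * `|t - s|.
Proof.
move=> Hf; wlog st : s t / s < t.
  move=> W hs ht; have [/W|/W|->] := ltgtP s t; last 1 first.
  - by rewrite !subrr normr0 mulr0.
  - exact.
  - by move=> /(_ ht hs); rewrite distrC (distrC s).
move=> /andP[ls sh] /andP[lt th].
have inside r : r \in `[s, t] -> lo <= r <= hi.
  rewrite in_itv /= => /andP[sr rt].
  by rewrite (le_trans ls sr) (le_trans rt th).
have [r||r rI ->] := @MVT R f df s t st.
- by move=> /subset_itv_oo_cc /inside /Hf[].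
- by apply: derivable_within_continuous => r /inside /Hf[[]].
rewrite normrM ler_wpM2r//.
by have [] := Hf r (inside r (subset_itv_oo_cc rI)).
Qed.

End LinearODE.

(** The interval [lo, hi] has length 2 delta, so the bound K_small on n K delta makes
    the Picard operator a contraction of ratio 1/2. *)
Section Picard.
Context {R : realType} {n : nat}.
Local Notation E := 'rV[R]_n.
Variables (A : 'I_n -> 'I_n -> R -> R) (tau delta K : R).
Hypothesis A_cont : forall i j, continuous (A i j).
Hypothesis delta_gt0 : 0 < delta.
Let lo := tau - delta.
Let hi := tau + delta.
Hypothesis K_ge0 : 0 <= K.
Hypothesis A_bound : forall i j t, lo <= t <= hi -> `|A i j t| <= K.
Hypothesis K_small : K *+ n * delta <= 4^-1.

Let le_lohi : lo <= hi.
Proof. by rewrite /lo /hi lerD2l ge0_cp// ltW. Qed.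

Let prim_ex (g : R -> R) : exists J : R -> R, continuous g ->
  forall t, lo <= t <= hi -> is_derive t 1 J (g t).
Proof.
have [cg|ncg] := pselect (continuous g); last by exists (fun=> 0).
have ab : tau - delta *+ 2 < tau + delta *+ 2.
  by rewrite ltrD2l gt0_cp// mulrn_wgt0.
have [J HJ] := antiderivative ab cg; exists J => _ t /andP[lt th].
apply: HJ; apply/andP; split.
  by apply: lt_le_trans lt; rewrite /lo ltrD2l ltrN2 mulr2n ltrDl.
by apply: (le_lt_trans th); rewrite /hi ltrD2l mulr2n ltrDl.
Qed.

Let prim (g : R -> R) : R -> R := projT1 (cid (prim_ex g)).

Let primP g : continuous g -> forall t, lo <= t <= hi -> is_derive t 1 (prim g) (g t).
Proof. exact: (projT2 (cid (prim_ex g))). Qed.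

Variables (t0 : R) (v : E).
Hypothesis t0_itv : lo <= t0 <= hi.

Let rhs (W : R -> E) (j : 'I_n) (s : R) := \sum_i W s 0 i * A i j s.

(* Evaluating the primitives at clamp lo hi t makes all the estimates uniform in
   t on the whole line. *)
Let picard (W : R -> E) (t : R) : E :=
  \row_j (v 0 j + (prim (rhs W j) (clamp lo hi t) - prim (rhs W j) t0)).

Let rhs_cont W j : continuous W -> continuous (rhs W j).
Proof.
move=> cW t; apply: cvg_bigsum => i; apply: cvgM; last exact: A_cont.
by apply: (cvg_comp _ (fun w : E => w 0 i) (cW t)); exact: coord_continuous.
Qed.

Let picard_cont W : continuous W -> continuous (picard W).
Proof.
move=> cW t; apply: cvg_row => j; rewrite mxE.
under eq_fun do rewrite mxE.
apply: cvgD; first exact: cvg_cst.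
apply: cvgB; last exact: cvg_cst.
apply: (cvg_comp _ (prim (rhs W j)) (@clamp_continuous _ lo hi t)).
apply: differentiable_continuous; apply/derivable1_diffP.
have rc := @rhs_cont W j cW.
by have [] := primP rc (clamp_itv t le_lohi).
Qed.

Let rhs_bound (d : 'I_n -> R) (M : R) j s : lo <= s <= hi ->
  (forall i, `|d i| <= M) -> `|\sum_i d i * A i j s| <= M * (K *+ n).
Proof.
move=> hs dM; rewrite (le_trans (ler_norm_sum _ _ _))//.
apply: (@le_trans _ _ (\sum_(i < n) M * K)); last first.
  by rewrite sumr_const card_ord -mulrnAr.
by apply: ler_sum => i _; rewrite normrM ler_pM// A_bound.
Qed.

Let half_bound (M x y : R) : 0 <= M -> lo <= x <= hi -> lo <= y <= hi ->
  M * (K *+ n) * `|x - y| <= M / 2.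
Proof.
move=> M0 /andP[lx xh] /andP[ly yh].
have xy : `|x - y| <= delta *+ 2.
  rewrite ler_norml; apply/andP; split.
    by rewrite lerNl opprB; move: lx yh; rewrite /lo /hi mulr2n; lra.
  by move: ly xh; rewrite /lo /hi mulr2n; lra.
rewrite -mulrA ler_wpM2l//.
apply: (le_trans (ler_wpM2l _ xy)); first exact: mulrn_wge0.
by rewrite mulrnAr -mulr_natr; move: K_small; move: (K *+ n * delta) => z; lra.
Qed.

Let picard_contract V W M : 0 <= M -> continuous V -> continuous W ->
  (forall s, `|V s - W s| <= M) -> forall t, `|picard V t - picard W t| <= M / 2.
Proof.
move=> M0 cV cW VW t; apply: norm_row_le; first by rewrite divr_ge0.
move=> j; rewrite !mxE.
pose f s := prim (rhs V j) s - prim (rhs W j) s.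
have -> : v 0 j + (prim (rhs V j) (clamp lo hi t) - prim (rhs V j) t0) -
  (v 0 j + (prim (rhs W j) (clamp lo hi t) - prim (rhs W j) t0)) =
  f (clamp lo hi t) - f t0.
  rewrite /f; move: (prim _ _) (prim _ _) (prim _ _) (prim _ _) (v 0 j).
  by move=> a b c d e; ring.
apply: (le_trans _ (half_bound M0 (clamp_itv t le_lohi) t0_itv)).
apply: (@mean_value_bound _ f (fun s => rhs V j s - rhs W j s) lo hi) => //; last first.
  exact: clamp_itv.
move=> r hr; split.
  by apply: is_deriveB; apply: primP => //; apply: rhs_cont.
rewrite /rhs -sumrB; under eq_bigr do rewrite -mulrBl.
apply: rhs_bound => // i.
by have := norm_coord_le (V r - W r) i; rewrite !mxE => /le_trans; apply.
Qed.

Let picard_first t : `|picard (fun=> v) t - v| <= `|v| / 2.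
Proof.
apply: norm_row_le; first by rewrite divr_ge0.
move=> j; rewrite !mxE addrC addKr.
apply: (le_trans _ (half_bound (normr_ge0 v) (clamp_itv t le_lohi) t0_itv)).
apply: (@mean_value_bound _ _ (rhs (fun=> v) j) lo hi) => //; last first.
  exact: clamp_itv.
move=> r hr; split; first by apply: primP => //; apply: rhs_cont => ?; exact: cvg_cst.
by apply: rhs_bound => // i; exact: norm_coord_le.
Qed.

Let it (k : nat) : R -> E := iter k picard (fun=> v).

Let it_cont k : continuous (it k).
Proof.
elim: k => [|k IH]; first by move=> t; exact: cvg_cst.
exact: picard_cont.
Qed.

Let it_step k t : `|it k.+1 t - it k t| <= `|v| / 2 ^+ k.+1.
Proof.
elim: k t => [|k IH] t; first exact: picard_first.
rewrite exprSr invfM mulrA.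
have C0 : 0 <= `|v| / 2 ^+ k.+1 by rewrite divr_ge0// exprn_ge0.
exact: (picard_contract C0 (@it_cont k.+1) (@it_cont k) IH).
Qed.

Lemma picard_solution : exists V : R -> E, [/\ continuous V, V t0 = v &
  forall t, lo < t < hi -> is_derive t 1 V (\row_j \sum_i V t 0 i * A i j t)].
Proof.
have lim_it t : exists l, forall k, `|l - it k t| <= `|v| / 2 ^+ k.
  exact: (geometric_limit (u := fun k => it k t) (normr_ge0 v) (fun k => it_step k t)).
have [V HV] := choice lim_it.
have cV : continuous V.
  move=> t; apply/cvgrPdist_le => e e0.
  have [k ke] := geometric_small `|v| (divr_gt0 e0 (ltr0n _ 3)).
  have /cvgrPdist_le /(_ _ (divr_gt0 e0 (ltr0n _ 3))) := @it_cont k t.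
  apply: filterS => s Hs.
  rewrite -(subrKA (it k t)) (le_trans (ler_normD _ _))//.
  rewrite -(subrKA (it k s) (it k t)).
  rewrite (le_trans (lerD (HV t k) (ler_normD _ _)))//.
  have := HV s k; rewrite distrC => Hs2.
  by move: ke Hs Hs2; set a := `|v| / _; set b := `|it k t - _|; set d := `|_ - V s|; lra.
have fixV t : V t = picard V t.
  apply/eqP; rewrite -subr_eq0 -normr_le0; apply/ler_addgt0Pr => e e0.
  have [k ke] := geometric_small `|v| e0; rewrite add0r.
  have C0 : 0 <= `|v| / 2 ^+ k by rewrite divr_ge0// exprn_ge0.
  have P1 := picard_contract C0 cV (@it_cont k) (fun s => HV s k) t.
  have P2 := HV t k.+1.
  rewrite -(subrKA (it k.+1 t)) (le_trans (ler_normD _ _))//.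
  rewrite exprSr invfM mulrA in P2.
  rewrite [X in _ + X]distrC; apply: (le_trans (lerD P2 P1)).
  by rewrite -splitr ltW.
exists V; split=> //.
  rewrite fixV; apply/rowP => j; rewrite mxE clamp_id//.
  by rewrite subrr addr0.
move=> t /andP[lt th]; apply/is_derive_row => j; rewrite mxE.
have near_lh : \forall s \near t, s \in `]lo, hi[
  by apply: near_in_itvoo; rewrite in_itv /= lt th.
have E1 : \forall s \near t, v 0 j + (prim (rhs V j) s - prim (rhs V j) t0) = V s 0 j.
  apply: filterS near_lh => s; rewrite in_itv /= => /andP[ls sh].
  by rewrite [in RHS]fixV mxE clamp_id// !ltW.
apply: near_eq_is_derive E1 _.
have dp : is_derive t 1 (prim (rhs V j)) (rhs V j t).
  by apply: primP; [exact: rhs_cont|rewrite !ltW].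
have := is_deriveD (is_derive_cst (v 0 j) t 1)
  (is_deriveB dp (is_derive_cst (prim (rhs V j) t0) t 1)).
by rewrite subr0 add0r; exact.
Qed.

End Picard.

(** The length delta depends neither on the initial value nor on the point t0 at
    which it is prescribed; t0 can be either end of an interval. *)
Lemma linear_ode_local (R : realType) (n : nat) (A : 'I_n -> 'I_n -> R -> R) (tau : R) :
  (forall i j, continuous (A i j)) ->
  exists2 delta : R, 0 < delta & forall t0 (v : 'rV[R]_n), `|t0 - tau| <= delta ->
    exists V : R -> 'rV[R]_n, [/\ continuous V, V t0 = v &
      forall t, `|t - tau| < delta ->
        is_derive t 1 V (\row_j \sum_i V t 0 i * A i j t)].
Proof.
move=> cA.
pose K := \sum_i \sum_j `|A i j tau| + 1.
have K0 : 0 <= K by rewrite addr_ge0// sumr_ge0// => i _; rewrite sumr_ge0.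
have AK i j : `|A i j tau| + 1 <= K.
  rewrite lerD2r (bigD1 i)//= (bigD1 j)//= -addrA lerDl addr_ge0//.
    exact: sumr_ge0.
  by apply: sumr_ge0 => k _; exact: sumr_ge0.
have : \forall t \near tau, forall ij : 'I_n * 'I_n, `|A ij.1 ij.2 t| <= K.
  apply: (@filter_forall R _ (fun ij t => `|A ij.1 ij.2 t| <= K) (nbhs tau) _) => -[i j].
  have /cvgrPdist_lt /(_ 1 ltr01) := cA i j tau.
  apply: filterS => t H; apply: le_trans (AK i j).
  rewrite -[A i j t](subrK (A i j tau)) (le_trans (ler_normD _ _))// addrC lerD2l.
  by rewrite distrC ltW.
move=> /nbhs_ballP[r /= r0 Hr].
pose delta := Num.min (r / 2) (4^-1 / (K *+ n + 1)).
have Kn : 0 < K *+ n + 1 by rewrite ltr_wpDl// mulrn_wge0.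
have d0 : 0 < delta by rewrite lt_min !divr_gt0.
exists delta => // t0 v; rewrite ler_distl => t0d.
have Hb i j t : tau - delta <= t <= tau + delta -> `|A i j t| <= K.
  rewrite -ler_distl => td; apply: (Hr _ _ (i, j)); rewrite -ball_normE /ball_ /= distrC.
  apply: (le_lt_trans td); rewrite gt_min; apply/orP; left.
  by rewrite ltr_pdivrMr// ltr_pMr// ltr1n.
have Ks : K *+ n * delta <= 4^-1.
  apply: (@le_trans _ _ ((K *+ n + 1) * delta)).
    by rewrite ler_pM2r// lerDl.
  rewrite mulrC -ler_pdivlMr//; by rewrite ge_min lexx orbT.
have [V [cV V0 dV]] := picard_solution cA d0 K0 Hb Ks v t0d.
by exists V; split=> // t; rewrite ltr_distl; exact: dV.
Qed.

(** * Parallel fields: changes of chart and gluing *)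

Section ChangeOfChart.
Context {R : realType} {n : nat} (M : smooth_manifold R n).
Local Notation E := 'rV[R]_n.
Local Notation cmap a := (chart_map (chart_of (a : atlas M))).
Local Notation cdom a := (chart_dom (chart_of (a : atlas M))).
Local Notation ovl a b := (overlap (chart_of (a : atlas M)) (chart_of (b : atlas M))).
Local Notation trans a b :=
  (transition (chart_of (a : atlas M)) (chart_of (b : atlas M))).
Context (D : lin_conn M).

Lemma derive_trans_row a b x (w : E) : ovl a b x ->
  'D_w (trans a b) x = \sum_i w 0 i *: 'D_(delta_mx 0 i) (trans a b) x.
Proof.
move=> abx; have dt := trans_differentiable abx.
rewrite {1}(row_sum_delta w) (derive_sumv _ dt).
by apply: eq_bigr => i _; exact: derive_scalev.
Qed.

Lemma derive_trans_coord a b x (w : E) j : ovl a b x ->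
  ('D_w (trans a b) x) 0 j = \sum_i w 0 i * ('D_(delta_mx 0 i) (trans a b) x) 0 j.
Proof.
move=> abx; rewrite (derive_trans_row w abx) summxE.
by apply: eq_bigr => i _; rewrite mxE.
Qed.

(** The law of change of the coefficients, lc_change, is what makes the parallel
    equation independent of the chart: the derivative of D_W tau (g) produces
    the second derivative of the transition map tau, which cancels against the
    inhomogeneous term of that law. *)
Lemma parallel_change (a b : atlas M) (g W : R -> E) (t : R) (xi : E) :
  ovl a b (g t) -> is_derive t 1 g xi ->
  is_derive t 1 W (- chr (lc_coef D a (g t)) (W t) xi) ->
  is_derive t 1 (fun s => 'D_(W s) (trans a b) (g s))
    (- chr (lc_coef D b (trans a b (g t))) ('D_(W t) (trans a b) (g t))
           ('D_xi (trans a b) (g t))).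
Proof.
move=> abx dg dW; set x := g t.
pose T i := 'D_(delta_mx 0 i) (trans a b).
have dT i : differentiable (T i) x by exact: derive_trans_differentiable.
have oab : open (ovl a b) by exact: overlap_open.
have gx : \forall s \near t, ovl a b (g s).
  have cg : g s @[s --> t] --> x.
    by apply: differentiable_continuous; apply/derivable1_diffP; have [] := dg.
  by apply: cg; exact: open_nbhs_nbhs.
have dTx j i : is_derive t 1 (fun s => T i (g s) 0 j) (('D_xi (T i) x) 0 j).
  by have /is_derive_row := is_derive_curve dg (dT i); exact.
have eD j : ('D_xi ('D_(W t) (trans a b)) x) 0 j = \sum_i W t 0 i * ('D_xi (T i) x) 0 j.
  transitivity (('D_xi (\sum_i (W t 0 i \*: T i)) x) 0 j).
    congr (fun_of_matrix _ 0 j).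
    apply: near_eq_derive; apply: (open_near oab abx) => z abz.
    by rewrite (derive_trans_row _ abz) fct_sumE.
  rewrite derive_sum; last by move=> i; apply: derivableZ; exact: diff_derivable.
  rewrite summxE; apply: eq_bigr => i _.
  by rewrite deriveZ ?mxE//; exact: diff_derivable.
have eC := lc_change D (W t) xi abx.
set dV := - chr _ _ _.
apply (proj2 (@is_derive_row R n (fun s => 'D_(W s) (trans a b) (g s)) t dV)).
move=> j.
have E1 : \forall s \near t, \sum_i W s 0 i * T i (g s) 0 j = ('D_(W s) (trans a b) (g s)) 0 j.
  by apply: filterS gx => s abs; exact/esym/derive_trans_coord.
apply: near_eq_is_derive E1 _.
apply: (is_derive_eq (is_derive_bigsum (fun i =>
  is_derive_mul ((is_derive_row _ _ _).1 dW i) (dTx j i)))).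
rewrite big_split /= -eD.
rewrite -[X in X + _](derive_trans_coord _ _ abx) (derive_oppv _ (trans_differentiable abx)).
by rewrite eC !mxE opprD addrAC addNr add0r.
Qed.

Lemma tcoord_tvec a p (y : E) : cdom a p -> tcoord a p (tvec a (cmap a p) y) = y.
Proof.
move=> ap; have := tvecK y (chart_map_cod ap).
by rewrite (chart_mapK ap).
Qed.

End ChangeOfChart.

Lemma gt_nbhsr {R : realFieldType} (x a : R) : a < x -> \forall y \near x, a < y.
Proof. by move=> ax; exact: open_nbhs_nbhs (conj (@open_gt _ a) ax). Qed.

Section Existence.
Context {R : realType} {n : nat} (M : smooth_manifold R n).
Local Notation E := 'rV[R]_n.
Local Notation cmap a := (chart_map (chart_of (a : atlas M))).
Local Notation cdom a := (chart_dom (chart_of (a : atlas M))).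
Local Notation ccod a := (chart_cod (chart_of (a : atlas M))).
Local Notation trans a b :=
  (transition (chart_of (a : atlas M)) (chart_of (b : atlas M))).
Context (D : lin_conn M) (c : R -> M).

Lemma parallel_on_glue S1 S2 (p q r : R) V1 V2 W :
  parallel_on D c S1 p q V1 -> parallel_on D c S2 q r V2 ->
  (forall s, s <= q -> W s = V1 s) -> (forall s, q <= s -> W s = V2 s) ->
  parallel_on D c (q :: S1 ++ S2) p r W.
Proof.
move=> par1 par2 W1 W2 a t; rewrite !in_itv /= => /andP[pt tr] act.
pose Va s := tcoord a (c s) (W s).
split.
  suff H P : nbhs (Va t) P -> \forall s \near t, s \in `[p, r] -> P (Va s).
    by move=> P nP; exact: (H P nP).
  move=> nP.
  have H1 : \forall s \near t, s <= q -> s \in `[p, r] -> P (tcoord a (c s) (V1 s)).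
    have [tq|qt] := leP t q; last first.
      by have := gt_nbhsr qt; apply: filterS => s; rewrite ltNge => /negbTE ->.
    have [|C _] := par1 a t _ act; first by rewrite in_itv /= pt tq.
    rewrite /Va (W1 t tq) in nP.
    have CP : \forall s \near t, s \in `[p, q] -> P (tcoord a (c s) (V1 s)) := C P nP.
    apply: filterS CP => s Hs sq; rewrite in_itv /= => /andP[ps _].
    by apply: Hs; rewrite /= in_itv /= ps sq.
  have H2 : \forall s \near t, q < s -> s \in `[p, r] -> P (tcoord a (c s) (V2 s)).
    have [qt|tq] := leP q t; last first.
      by have := lt_nbhsl tq; apply: filterS => s sq /(lt_trans sq); rewrite ltxx.
    have [|C _] := par2 a t _ act; first by rewrite in_itv /= qt tr.
    rewrite /Va (W2 t qt) in nP.
    have CP : \forall s \near t, s \in `[q, r] -> P (tcoord a (c s) (V2 s)) := C P nP.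
    apply: filterS CP => s Hs qs; rewrite in_itv /= => /andP[_ sr].
    by apply: Hs; rewrite /= in_itv /= sr ltW.
  apply: filterS2 H1 H2 => s h1 h2 sI; rewrite /Va.
  have [sq|qs] := leP s q; first by rewrite (W1 s sq); exact: h1.
  by rewrite (W2 s (ltW qs)); exact: h2.
rewrite inE mem_cat !negb_or => /andP[pt' tr'] /and3P[tq tS1 tS2].
have [ltq|] := ltP t q.
  have [|_ H] := par1 a t _ act; first by rewrite in_itv /= pt ltW.
  rewrite (W1 t (ltW ltq)).
  have tpq : t \in `]p, q[ by rewrite in_itv /= pt' ltq.
  apply: near_eq_is_derive (H tpq tS1).
  have := lt_nbhsl ltq; apply: filterS => s sq.
  by rewrite (W1 s (ltW sq)).
rewrite le_eqVlt eq_sym (negbTE tq) /= => gtq.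
have [|_ H] := par2 a t _ act; first by rewrite in_itv /= tr ltW.
rewrite (W2 t (ltW gtq)).
have tqr : t \in `]q, r[ by rewrite in_itv /= gtq tr'.
apply: near_eq_is_derive (H tqr tS2).
have := gt_nbhsr gtq; apply: filterS => s sq.
by rewrite (W2 s (ltW sq)).
Qed.

End Existence.

(** * Existence of parallel fields *)

Section LocalExistence.
Context {R : realType} {n : nat} (M : smooth_manifold R n).
Local Notation E := 'rV[R]_n.
Local Notation cmap a := (chart_map (chart_of (a : atlas M))).
Local Notation cdom a := (chart_dom (chart_of (a : atlas M))).
Local Notation ccod a := (chart_cod (chart_of (a : atlas M))).
Local Notation trans a b :=
  (transition (chart_of (a : atlas M)) (chart_of (b : atlas M))).
Context (D : lin_conn M) (c : R -> M) (S' : seq R).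
Hypothesis c_cont : {within `[0%R, 1%R], continuous c}.
Hypothesis c_C1 : forall a (t : R), t \in `[0, 1] -> cdom a (c t) ->
    [/\ t \in `]0, 1[ -> t \notin S' ->
          derivable (cmap a \o c) t 1 /\
          {for t, continuous (derive1 (cmap a \o c))},
        t < 1 -> cvg (derive1 (cmap a \o c) s @[s --> t^'+])
      & 0 < t -> cvg (derive1 (cmap a \o c) s @[s --> t^'-])].

Lemma continuous_comp_clamp {T : topologicalType} (f : R -> T) (p q : R) : p <= q ->
  {within `[p, q], continuous f} -> continuous (f \o clamp p q).
Proof.
move=> pq /subspace_continuousP cf t.
have It s : `[p, q]%classic (clamp p q s) by rewrite /= in_itv /= clamp_itv.
apply: (@cvg_comp _ _ _ (clamp p q) f _ (within `[p, q] (nbhs (clamp p q t)))).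
  move=> P; rewrite /within /= => nP.
  have : \forall s \near t, `[p, q]%classic (clamp p q s) -> P (clamp p q s).
    exact: (@clamp_continuous _ p q t _ nP).
  by apply: filterS => s; apply.
exact: cf.
Qed.

(** Between two exceptional points the velocity of the path is continuous and has
    limits at both ends, so the coefficients of the parallel equation extend
    continuously to the whole line. *)
Lemma coefficient_extension a (p q : R) : 0 <= p -> p < q -> q <= 1 ->
  (forall s, p <= s <= q -> cdom a (c s)) ->
  (forall s, p < s < q -> s \notin S') ->
  exists A : 'I_n -> 'I_n -> R -> R, (forall i j, continuous (A i j)) /\
    forall s, p < s < q -> forall w : E,
      \row_j \sum_i w 0 i * A i j s =
      - chr (lc_coef D a (cmap a (c s))) w ('D_1 (cmap a \o c) s).
Proof.
move=> p0 pq q1 acs nS.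
have I01 s : p <= s <= q -> s \in `[0, 1].
  by move=> /andP[ps sq]; rewrite in_itv /= (le_trans p0 ps) (le_trans sq q1).
have Ip : p <= p <= q by rewrite lexx ltW.
have Iq : p <= q <= q by rewrite lexx ltW.
have [_ /(_ (lt_le_trans pq q1)) cp _] := c_C1 (I01 p Ip) (acs p Ip).
have [_ _ /(_ (le_lt_trans p0 pq)) cq] := c_C1 (I01 q Iq) (acs q Iq).
set d1 := derive1 (cmap a \o c) in cp cq.
pose f s := if s <= p then lim (d1 r @[r --> p^'+])
            else if q <= s then lim (d1 r @[r --> q^'-]) else d1 s.
have fd s : p < s < q -> f s = d1 s.
  by move=> /andP[ps sq]; rewrite /f leNgt ps leNgt sq.
have cf : {within `[p, q], continuous f}.
  apply/(continuous_within_itvP _ pq); split.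
  - move=> s; rewrite in_itv /= => psq; have /andP[ps sq] := psq.
    have Is : p <= s <= q by rewrite !ltW.
    have s01 : s \in `]0, 1[ by rewrite in_itv /= (le_lt_trans p0 ps) (lt_le_trans sq q1).
    have [/(_ s01 (nS s psq))[_ cd] _ _] := c_C1 (I01 s Is) (acs s Is).
    suff : f r @[r --> s] --> d1 s by rewrite -(fd s psq).
    apply: cvg_trans cd; apply: near_eq_cvg.
    have : \forall r \near s, r \in `]p, q[ by apply: near_in_itvoo; rewrite in_itv /= psq.
    by apply: filterS => r; rewrite in_itv /= => /fd.
  - have -> : f p = lim (d1 r @[r --> p^'+]) by rewrite /f lexx.
    apply: cvg_trans cp; apply: near_eq_cvg.
    near=> r; apply/esym/fd; apply/andP; split; near: r; first exact: nbhs_right_gt.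
    exact: nbhs_right_lt.
  - have -> : f q = lim (d1 r @[r --> q^'-]) by rewrite /f leNgt pq lexx.
    apply: cvg_trans cq; apply: near_eq_cvg.
    near=> r; apply/esym/fd; apply/andP; split; near: r; first exact: nbhs_left_gt.
    exact: nbhs_left_lt.
have cg : {within `[p, q], continuous (cmap a \o c)}.
  apply/subspace_continuousP => s; rewrite /= in_itv /= => Is.
  have := path_chart_cvg c_cont (I01 s Is) (acs s Is).
  apply: cvg_trans => P; apply: within_subset => r /=; rewrite in_itv /=.
  exact: I01.
have clI t : p <= clamp p q t <= q by exact: clamp_itv (ltW pq).
pose ga := (cmap a \o c) \o clamp p q.
have cga : continuous ga by exact: continuous_comp_clamp (ltW pq) cg.
have cfa : continuous (f \o clamp p q) by exact: continuous_comp_clamp (ltW pq) cf.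
exists (fun i j s => - \sum_k lc_coef D a (ga s) j i k * f (clamp p q s) 0 k).
split.
  move=> i j t; apply: cvgN; apply: cvg_bigsum => k; apply: cvgM.
    apply: (cvg_comp _ (fun x => lc_coef D a x j i k) (cga t)).
    by apply: (lc_smooth D a j i k 0); apply: chart_map_cod; exact: acs.
  by apply: (cvg_comp _ (fun v : E => v 0 k) (cfa t)); exact: coord_continuous.
move=> s psq w; have Is : p <= s <= q by have /andP[ps sq] := psq; rewrite !ltW.
rewrite /ga /= (clamp_id Is) (fd s psq) /d1 derive1E.
apply/rowP => j; rewrite !mxE -sumrN; apply: eq_bigr => i _.
rewrite mulrN mulr_sumr; congr (- _); apply: eq_bigr => k _.
by rewrite mulrA (mulrC (w 0 i)).
Unshelve. all: by end_near. Qed.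

(** Values can be prescribed at either end: the left end gives the transport of
    every vector, the right end its surjectivity. *)
Definition transportable (p q : R) : Prop :=
  (forall v, exists S V, parallel_on D c S p q V /\ V p = v) /\
  (forall v, exists S V, parallel_on D c S p q V /\ V q = v).

(** A solution of the parallel equation in one chart is a parallel field in every
    chart. *)
Lemma ode_parallel a (p q : R) (W : R -> E) : 0 <= p -> p <= q -> q <= 1 ->
  (forall s, p <= s <= q -> cdom a (c s)) ->
  (forall s, p < s < q -> s \notin S') ->
  continuous W ->
  (forall s, p < s < q -> is_derive s 1 W
     (- chr (lc_coef D a (cmap a (c s))) (W s) ('D_1 (cmap a \o c) s))) ->
  parallel_on D c [::] p q (fun s => tvec a (cmap a (c s)) (W s)).
Proof.
move=> p0 pq q1 acs nS cW dW b t tpq bct; rewrite in_itv /= in tpq.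
have I01 s : p <= s <= q -> s \in `[0, 1].
  by move=> /andP[ps sq]; rewrite in_itv /= (le_trans p0 ps) (le_trans sq q1).
have act := acs t tpq.
have abt : overlap (chart_of a) (chart_of b) (cmap a (c t)) by exact: overlap_map.
pose Psi s := 'D_(W s) (trans a b) (cmap a (c s)).
pose Vb s := tcoord b (c s) (tvec a (cmap a (c s)) (W s)).
have VbE s : p <= s <= q -> cdom b (c s) -> Psi s = Vb s.
  by move=> /acs as_ bs; rewrite /Vb (tcoord_trans _ as_ bs) tcoord_tvec.
have nb := path_near_chart c_cont (I01 t tpq) bct.
have na := path_near_chart c_cont (I01 t tpq) act.
have wsub (P : R -> Prop) : (\forall s \near within `[0, 1] (nbhs t), P s) ->
    \forall s \near within `[p, q] (nbhs t), P s.
  by apply: within_subset => r /=; rewrite in_itv /=; exact: I01.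
split.
  suff : Vb s @[s --> within `[p, q] (nbhs t)] --> Vb t by [].
  rewrite -(VbE t tpq bct).
  have nE : \forall s \near within `[p, q] (nbhs t), Psi s = Vb s.
    have := wsub _ nb; rewrite !near_withinE; apply: filterS => s H Is.
    by apply: VbE; [move: Is; rewrite /= in_itv|exact: H].
  apply: cvg_trans (near_eq_cvg nE) _.
  have cg : cmap a (c s) @[s --> within `[p, q] (nbhs t)] --> cmap a (c t).
    have cc := path_chart_cvg c_cont (I01 t tpq) act.
    by move=> P nP; exact: (wsub _ (cc P nP)).
  have cW' : W s @[s --> within `[p, q] (nbhs t)] --> W t.
    by apply: cvg_within_filter; exact: cW.
  apply: cvg_row => j; rewrite (derive_trans_coord _ _ abt).
  have nF : \forall s \near within `[p, q] (nbhs t),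
     \sum_i W s 0 i * ('D_(delta_mx 0 i) (trans a b) (cmap a (c s))) 0 j = Psi s 0 j.
    have nab : \forall s \near within `[0, 1] (nbhs t), cdom a (c s) /\ cdom b (c s).
      exact: filterI na nb.
    have := wsub _ nab; rewrite !near_withinE; apply: filterS => s H Is.
    have [as_ bs] := H Is.
    by apply/esym/derive_trans_coord; exact: overlap_map.
  apply: cvg_trans (near_eq_cvg nF) _.
  apply: cvg_bigsum => i; apply: cvgM.
    by apply: (cvg_comp _ (fun v : E => v 0 i) cW'); exact: coord_continuous.
  have cT := differentiable_continuous (derive_trans_differentiable (delta_mx 0 i) abt).
  have cj := @coord_continuous R 1 n 0 j.
  exact: (cvg_comp _ _ (cvg_comp _ _ cg cT) (cj _)).
rewrite in_itv /= => tpq' _.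
have t01' : t \in `]0, 1[.
  by have /andP[pt tq] := tpq'; rewrite in_itv /= (le_lt_trans p0 pt) (lt_le_trans tq q1).
have dc := path_is_derive c_C1 t01' (nS t tpq') act.
have dPsi := parallel_change abt dc (dW t tpq').
have dcb : 'D_1 (cmap b \o c) t = 'D_('D_1 (cmap a \o c) t) (trans a b) (cmap a (c t)).
  have [_ <-] := is_derive_curve dc (trans_differentiable abt).
  apply: near_eq_derive; apply: filterS (near_inner t01' na) => s as_ /=.
  by rewrite trans_map.
have nE : \forall s \near t, Psi s = Vb s.
  have : \forall s \near t, s \in `]p, q[ by apply: near_in_itvoo; rewrite in_itv /= tpq'.
  apply: filterS2 (near_inner t01' nb) => s bs; rewrite in_itv /= => /andP[ps sq].
  by apply: VbE => //; rewrite !ltW.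
have := near_eq_is_derive nE dPsi.
by rewrite -[tcoord b (c t) _](VbE t tpq bct) dcb (trans_map _ act).
Qed.

Lemma transportable_refl p : transportable p p.
Proof.
have par v : parallel_on D c [::] p p (fun=> v).
  move=> a t; rewrite !in_itv /= => /andP[pt tp] act.
  have -> : t = p by apply/le_anti; rewrite pt tp.
  split; last by rewrite ltxx.
  set l := tcoord a (c p) v => P nP.
  have H : \forall s \near p, `[p, p]%classic s -> P (tcoord a (c s) v).
    apply: filterE => s /=; rewrite in_itv /= => /le_anti <-.
    exact: nbhs_singleton.
  exact: H.
by split=> v; exists [::], (fun=> v).
Qed.

Lemma transportable_trans p q r : p <= q -> q <= r ->
  transportable p q -> transportable q r -> transportable p r.
Proof.
move=> pq qr [Lpq Rpq] [Lqr Rqr].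
have glue S1 S2 V1 V2 : parallel_on D c S1 p q V1 -> parallel_on D c S2 q r V2 ->
    V1 q = V2 q -> exists S V, [/\ parallel_on D c S p r V, V p = V1 p & V r = V2 r].
  move=> par1 par2 V12; pose W s := if s <= q then V1 s else V2 s.
  have W1 s : s <= q -> W s = V1 s by rewrite /W => ->.
  have W2 s : q <= s -> W s = V2 s.
    rewrite le_eqVlt => /predU1P[<-|qs]; first by rewrite W1.
    by rewrite /W leNgt qs.
  exists (q :: S1 ++ S2), W.
  by split; [exact: parallel_on_glue par1 par2 W1 W2|exact: W1|exact: W2].
split=> v.
  have [S1 [V1 [par1 V1p]]] := Lpq v; have [S2 [V2 [par2 V2q]]] := Lqr (V1 q).
  have [S [V [par Vp _]]] := glue _ _ _ _ par1 par2 (esym V2q).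
  by exists S, V; rewrite Vp V1p.
have [S2 [V2 [par2 V2r]]] := Rqr v; have [S1 [V1 [par1 V1q]]] := Rpq (V2 q).
have [S [V [par _ Vr]]] := glue _ _ _ _ par1 par2 V1q.
by exists S, V; rewrite Vr V2r.
Qed.

Lemma transportable_near a (p q tau : R) : 0 <= p -> p < q -> q <= 1 ->
  (forall s, p <= s <= q -> cdom a (c s)) ->
  (forall s, p < s < q -> s \notin S') ->
  exists2 d, 0 < d & forall p' q', p <= p' -> p' <= q' -> q' <= q ->
    tau - d < p' -> q' < tau + d -> transportable p' q'.
Proof.
move=> p0 pq q1 acs nS.
have [A [cA eA]] := coefficient_extension p0 pq q1 acs nS.
have [d d0 Hd] := @linear_ode_local R n A tau cA.
exists d => // p' q' pp pq' qq pd qd.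
have ode t0 v : p' <= t0 <= q' ->
    exists S V, parallel_on D c S p' q' V /\ V t0 = v.
  move=> /andP[pt tq].
  have act : cdom a (c t0) by apply: acs; rewrite (le_trans pp pt) (le_trans tq qq).
  have [|W [cW W0 dW]] := Hd t0 (tcoord a (c t0) v).
    by rewrite ler_distl !ltW// ?(lt_le_trans pd pt)// (le_lt_trans tq qd).
  exists [::], (fun s => tvec a (cmap a (c s)) (W s)); split; last first.
    by rewrite W0 tcoordK.
  apply: ode_parallel => //.
  - exact: le_trans pp.
  - exact: le_trans qq q1.
  - by move=> s /andP[ps sq]; apply: acs; rewrite (le_trans pp ps) (le_trans sq qq).
  - by move=> s /andP[ps sq]; apply: nS; rewrite (le_lt_trans pp ps) (lt_le_trans sq qq).
  move=> s /andP[ps sq].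
  have psq : p < s < q by rewrite (le_lt_trans pp ps) (lt_le_trans sq qq).
  rewrite -(eA s psq); apply: dW.
  by rewrite ltr_distl (lt_trans pd ps) (lt_trans sq qd).
by split=> v; apply: ode; rewrite ?lexx ?pq'.
Qed.

Lemma transportable_path : transportable 0 1.
Proof.
apply: (@interval_ind _ 0 1 transportable ler01 (transportable_refl 0)).
  by move=> p q r _ pq qr _; exact: transportable_trans.
move=> t t01; pose a := chart_at (c t).
have It : t \in `[0, 1] by rewrite in_itv.
have := path_near_chart c_cont It (chart_at_dom (c t)).
rewrite near_withinE => /nbhs_ballP[r /= r0 Hr].
have [e e0 Se] := isolate_seq S' t.
(* At distance less than m from t, the path stays in the chart a and t is the only
   possible exceptional point. *)
pose m := Num.min r e.
have m0 : 0 < m by rewrite lt_min r0.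
have inm s : `|s - t| < m -> 0 <= s <= 1 -> cdom a (c s) /\ (s != t -> s \notin S').
  rewrite lt_min => /andP[sr se] s01; split.
    by apply: Hr; [rewrite -ball_normE /ball_ /= distrC|rewrite /= in_itv].
  by move=> st; exact: notin_near Se st se.
have m2 : m / 2 < m by rewrite ltr_pdivrMr// ltr_pMr// ltr1n.
have m20 : 0 < m / 2 by rewrite divr_gt0.
have /andP[t0 t1] := t01.
have [dl dl0 Hl] : exists2 d, 0 < d &
    forall p, 0 <= p -> t - d < p -> p < t -> transportable p t.
  have [->|tn0] := eqVneq t 0.
    by exists 1 => // p p0 _ /(le_lt_trans p0); rewrite ltxx.
  have tgt0 : 0 < t by rewrite lt_neqAle eq_sym tn0.
  pose p0 := Num.max 0 (t - m / 2).
  have p00 : 0 <= p0 by rewrite le_max lexx.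
  have p0t : p0 < t by rewrite gt_max tgt0 ltrBlDr ltrDl.
  have near_t s : p0 <= s <= t -> `|s - t| < m.
    rewrite ge_max => /andP[/andP[_ ps] st].
    rewrite ler0_norm ?subr_le0// opprB ltrBlDr -ltrBlDl.
    by apply: lt_le_trans ps; rewrite ltrD2l ltrN2.
  have [|s /andP[ps st]|d d0 Hd] := @transportable_near a p0 t t p00 p0t t1.
  - move=> s /[dup] /near_t H /andP[ps st]; have [] := inm s H => //.
    by rewrite (le_trans p00 ps) (le_trans st t1).
  - have [||_] := inm s; last by apply; rewrite lt_eqF.
      by apply: near_t; rewrite !ltW.
    by rewrite (le_trans p00 (ltW ps)) (le_trans (ltW st) t1).
  exists (Num.min d (t - p0)); first by rewrite lt_min d0 subr_gt0.
  move=> p _ dp pt; apply: Hd => //.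
  - apply: ltW; apply: le_lt_trans dp.
    by rewrite lerBrDr -lerBrDl ge_min lexx orbT.
  - exact: ltW.
  - by apply: le_lt_trans dp; rewrite lerD2l lerN2 ge_min lexx.
  - by rewrite ltrDl.
have [dr dr0 Hq] : exists2 d, 0 < d &
    forall q, q <= 1 -> t < q -> q < t + d -> transportable t q.
  have [->|tn1] := eqVneq t 1.
    by exists 1 => // q q1 /lt_le_trans /(_ q1); rewrite ltxx.
  have tlt1 : t < 1 by rewrite lt_neqAle tn1.
  pose q0 := Num.min 1 (t + m / 2).
  have q01 : q0 <= 1 by rewrite ge_min lexx.
  have tq0 : t < q0 by rewrite lt_min tlt1 ltrDl.
  have near_t s : t <= s <= q0 -> `|s - t| < m.
    rewrite le_min => /andP[ts /andP[_ sq]].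
    rewrite ger0_norm ?subr_ge0// ltrBlDl.
    by apply: (le_lt_trans sq); rewrite ltrD2l.
  have [|s /andP[ps st]|d d0 Hd] := @transportable_near a t q0 t t0 tq0 q01.
  - move=> s /[dup] /near_t H /andP[ps st]; have [] := inm s H => //.
    by rewrite (le_trans t0 ps) (le_trans st q01).
  - have [||_] := inm s; last by apply; rewrite gt_eqF.
      by apply: near_t; rewrite !ltW.
    by rewrite (le_trans t0 (ltW ps)) (le_trans (ltW st) q01).
  exists (Num.min d (q0 - t)); first by rewrite lt_min d0 subr_gt0.
  move=> q _ tq qd; apply: Hd => //.
  - exact: ltW.
  - by apply/ltW/(lt_le_trans qd); rewrite -lerBrDl ge_min lexx orbT.
  - by rewrite ltrBlDr ltrDl.
  - by apply: (lt_le_trans qd); rewrite lerD2l ge_min lexx.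
exists (Num.min dl dr); first by rewrite lt_min dl0.
split=> s hs s1 s2.
  apply: Hl => //; apply: le_lt_trans s1.
  by rewrite lerD2l lerN2 ge_min lexx.
apply: Hq => //; apply: (lt_le_trans s2).
by rewrite lerD2l ge_min lexx orbT.
Qed.

End LocalExistence.

(** * Invariance of the indicatrix *)

Lemma metric_sub (R : realType) (n : nat) (M : smooth_manifold R n)
  (h : M -> 'rV[R]_n -> 'rV[R]_n -> R) (p : M) (u v : 'rV[R]_n) : riemannian h ->
  h p (u - v) (u - v) = h p u u - h p u v - (h p u v - h p v v).
Proof.
move=> [hlin hsym _ _].
have hB w : h p w (u - v) = h p w u - h p w v.
  by rewrite addrC -scaleN1r hlin mulN1r addrC.
by rewrite hB !(hsym _ (u - v)) !hB (hsym _ v u).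
Qed.

Lemma finsler_0 (R : realType) (n : nat) (M : smooth_manifold R n)
  (F : M -> 'rV[R]_n -> R) (p : M) : finsler F -> F p 0 = 0.
Proof.
move=> Ff; have := finsler_hom Ff p 0 (ltr0n R 2).
by rewrite scaler0 mulr_natl mulr2n => /esym/eqP; rewrite -subr_eq0 addrK => /eqP.
Qed.

Unset Implicit Arguments.

Theorem proposition5p3p6 (R : realType) (n : nat) (M : smooth_manifold R n)
  (F : M -> 'rV[R]_n -> R) (finslerF : finsler F) (berwaldF : berwald F)
  (h : M -> 'rV[R]_n -> 'rV[R]_n -> R) (riemh : riemannian h)
  (parh : berwald_parallel F h)
  (D : lin_conn M) (lcD : levi_civita h D)
  (c : R -> M) (x z : M) (c0 : c 0 = x) (c1 : c 1 = z)
  (pathc : piecewise_C1 c) :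
  transport D c @` indicatrix F x = indicatrix F z.
Proof.
have [Dc [chernF Dc_y]] := berwaldF.
have [c_cont [S' c_C1]] := pathc.
have I0 : (0 : R) \in `[0, 1] by rewrite in_itv /= lexx ler01.
have I1 : (1 : R) \in `[0, 1] by rewrite in_itv /= lexx ler01.
have metric_const S1 S2 U V : parallel_on D c S1 0 1 U -> parallel_on D c S2 0 1 V ->
    forall t, t \in `[0, 1] -> h (c t) (U t) (V t) = h (c 0) (U 0) (V 0).
  exact: (parallel_metric c_cont c_C1 riemh lcD).
have hpos p v : v != 0 -> h p v v != 0 by move=> v0; rewrite gt_eqF// riem_pos.
have h0 p : h p 0 0 = 0.
  by have := riem_lin riemh p 0 (-1) 0 0; rewrite scaler0 addr0 mulN1r addNr.
(* h(V, V) is constant along a parallel field V. *)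
have nonzero S1 V : parallel_on D c S1 0 1 V -> forall s t, s \in `[0, 1] ->
    t \in `[0, 1] -> V s != 0 -> V t != 0.
  move=> par s t s01 t01 Vs; apply/eqP => Vt; move: (hpos (c s) _ Vs).
  rewrite (metric_const _ _ _ _ par par s s01).
  by rewrite -(metric_const _ _ _ _ par par t t01) Vt h0 eqxx.
(* Two parallel fields with the same origin coincide at the end, as the norm of
   their difference, expanded by bilinearity, is constant. *)
have transportE S1 V : parallel_on D c S1 0 1 V -> transport D c (V 0) = V 1.
  move=> par.
  have : [set w | exists V', [/\ parallel D c V', V' 0 = V 0 & V' 1 = w]] (V 1).
    by exists V; split=> //; apply/parallelP; exists S1.
  move=> /(xgetI 0) [W [/parallelP[S2 parW] W0 W1]].
  rewrite /transport -W1; apply/eqP; rewrite -subr_eq0; apply/negPn/negP => W1V.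
  move: (hpos (c 1) _ W1V); rewrite metric_sub//.
  rewrite (metric_const _ _ _ _ parW parW 1 I1) (metric_const _ _ _ _ parW par 1 I1).
  by rewrite (metric_const _ _ _ _ par par 1 I1) W0 !subrr eqxx.
have F_const S1 V : parallel_on D c S1 0 1 V -> V 0 != 0 -> F z (V 1) = F x (V 0).
  move=> par V0.
  have Fsq : F (c 1) (V 1) ^+ 2 = F (c 0) (V 0) ^+ 2.
    apply: (parallel_finsler c_cont c_C1 _ _ par) => //.
    - by move=> a u; exact: local_F_sq_differentiable.
    - move=> a x' y xi.
      exact: (local_F_sq_horizontal finslerF chernF Dc_y riemh parh lcD).
    - by move=> t t01; exact: (nonzero _ _ par 0 t I0 t01 V0).
  rewrite -c0 -c1; apply/eqP.
  by rewrite -(eqrXn2 (isT : (0 < 2)%N)) ?(finsler_ge0 finslerF)// Fsq.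
have indicatrix_neq0 p y : indicatrix F p y -> y != 0.
  move=> Fy; apply/eqP => y0; move: Fy; rewrite /indicatrix /= y0 finsler_0//.
  by move/eqP; rewrite eq_sym oner_eq0.
have [fwd bwd] := @transportable_path R n M D c S' c_cont c_C1.
apply/seteqP; split => [_ [y Fy <-]|y Fy].
  have [S1 [V [par V0]]] := fwd y.
  rewrite -V0 (transportE _ _ par) /indicatrix /= (F_const _ _ par) V0//.
  exact: indicatrix_neq0 Fy.
have [S1 [V [par V1]]] := bwd y.
have V00 : V 0 != 0.
  by apply: (nonzero _ _ par 1 0 I1 I0); rewrite V1; exact: indicatrix_neq0 Fy.
exists (V 0); last by rewrite (transportE _ _ par).
by rewrite /indicatrix /= -(F_const _ _ par V00) V1.
Qed.
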